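(* Let $(X,m)$ be a locally compact metric space and let $C_0(X)$ be the C*-algebra of complex valued continuous functions on $X$ vanishing at infinity. Let $\mathsf{Lip}_m$ be the Lipschitz seminorm $$\mathsf{Lip}_m(f)=\sup\left\{\frac{|f(y)-f(x)|}{m(y,x)}:x,y\in X\text{ and }x\neq y\right\},$$ defined on the real-valued $f\in C_0(X)$ for which this supremum is finite. The Lipschitz triple $(C_0(X),\mathsf{Lip}_m,C_0(X))$ is a quantum locally compact metric space.
   Context: For a C*-algebra $\mathfrak{A}$: $\mathfrak{u}\mathfrak{A}$ is $\mathfrak{A}$ if $\mathfrak{A}$ is unital and its standard unitization $\mathfrak{A}\oplus\mathbb{C}$ otherwise, with unit $1$; $\mathfrak{sa}(\cdot)$ denotes self-adjoint elements; $\mathscr{S}(\mathfrak{A})$ is the state space; each state is identified with its unique extension to a state of $\mathfrak{u}\mathfrak{A}$ and with its normal extension to the von Neumann algebra $\mathfrak{A}^{\ast\ast}$ (which contains $\mathfrak{u}\mathfrak{A}$). The weak* topology is $\sigma(\mathfrak{A}^\ast,\mathfrak{A})$. A Lipschitz pair $(\mathfrak{A},\mathsf{L})$ is a C*-algebra $\mathfrak{A}$ with a seminorm $\mathsf{L}$ defined on a dense subspace of $\mathfrak{sa}(\mathfrak{u}\mathfrak{A})$ such that $\{a\in\mathfrak{sa}(\mathfrak{u}\mathfrak{A}):\mathsf{L}(a)=0\}=\mathbb{R}1$ (writing $\mathsf{L}(a)\leq 1$ presumes $a$ is in the domain). Convention: if $\mathfrak{A}$ is not unital and $\mathsf{L}$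 is a norm defined on a dense subspace of $\mathfrak{sa}(\mathfrak{A})$, then $\mathsf{L}$ is extended by $\mathsf{L}(a+\lambda1)=\mathsf{L}(a)$ for $a\in\mathfrak{sa}(\mathfrak{A})$ in the domain and $\lambda\in\mathbb{R}$, and $(\mathfrak{A},\mathsf{L})$ is regarded as a Lipschitz pair through this extension. The extended Monge-Kantorovich metric is $\mathsf{mk}_{\mathsf{L}}(\varphi,\psi)=\sup\{|\varphi(a)-\psi(a)|:a\in\mathfrak{sa}(\mathfrak{A}),\ \mathsf{L}(a)\leq1\}\in[0,\infty]$ for $\varphi,\psi\in\mathscr{S}(\mathfrak{A})$. For a state $\mu$, $\mathfrak{L}_1(\mathfrak{A},\mathsf{L},\mu)=\{a\in\mathfrak{sa}(\mathfrak{u}\mathfrak{A}):\mathsf{L}(a)\leq1\text{ and }\mu(a)=0\}$. A topographic quantum space $(\mathfrak{A},\mathfrak{M})$ is a C*-algebra $\mathfrak{A}$ with an Abelian C*-subalgebra $\mathfrak{M}$ containing an approximate identity for $\mathfrak{A}$. $\sigma(\mathfrak{M})$ is the Gel'fand spectrum of $\mathfrak{M}$; $\mathcal{K}(\sigma(\mathfrak{M}))$ is the set of its compact subsets, directed so that larger sets come later; for $K\in\mathcal{K}(\sigma(\mathfrak{M}))$, $\chi_K$ is the indicator function of $K$, a projection in $\mathfrak{M}^{\ast\ast}\subseteq\mathfrak{A}^{\ast\ast}$. Set $\mathscr{S}(\mathfrak{A}|K)=\{\varphi\in\mathscr{S}(\mathfrak{A}):\varphi(\chi_K)=1\}$ and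 $\mathscr{S}(\mathfrak{A}|\mathfrak{M})=\bigcup_{K\in\mathcal{K}(\sigma(\mathfrak{M}))}\mathscr{S}(\mathfrak{A}|K)$ (local states). A Lipschitz triple $(\mathfrak{A},\mathsf{L},\mathfrak{M})$ is a Lipschitz pair $(\mathfrak{A},\mathsf{L})$ together with an Abelian C*-subalgebra $\mathfrak{M}$ such that $(\mathfrak{A},\mathfrak{M})$ is a topographic quantum space. It is regular when every $\mathscr{S}(\mathfrak{A}|K)$, $K\in\mathcal{K}(\sigma(\mathfrak{M}))$, has finite diameter for $\mathsf{mk}_{\mathsf{L}}$. A subset $\mathscr{K}\subseteq\mathscr{S}(\mathfrak{A})$ is tame when, for some $\mu\in\mathscr{S}(\mathfrak{A}|\mathfrak{M})$, $\lim_{K\in\mathcal{K}(\sigma(\mathfrak{M}))}\sup\{|\varphi(a-\chi_Ka\chi_K)|:a\in\mathfrak{L}_1(\mathfrak{A},\mathsf{L},\mu),\varphi\in\mathscr{K}\}=0$. A quantum locally compact metric space is a regular Lipschitz triple such that, for every tame $\mathscr{K}\subseteq\mathscr{S}(\mathfrak{A})$, the topology of $(\mathscr{K},\mathsf{mk}_{\mathsf{L}})$ is the relative weak* topology on $\mathscr{K}$. *)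

(* Defs.v *)
From HB Require Import structures.
From mathcomp Require Import all_boot all_order all_algebra.
From mathcomp Require Import lra complex.
From mathcomp Require Import all_classical all_reals all_analysis.

Set Implicit Arguments.
Unset Strict Implicit.
Unset Printing Implicit Defensive.

Import Order.TTheory GRing.Theory Num.Theory numFieldNormedType.Exports.

Local Open Scope classical_set_scope.
Local Open Scope complex_scope.
Local Open Scope ring_scope.

(* [R[i]] carries its topology and its normed module structure through the
   alias [_^o]; norms of complex normed modules are valued in [R[i]]. *)
Notation Cplx R := (R[i]^o).

HB.mixin Record isCStarAlgebra (R : realType) A
    & CompleteNormedModule R[i] A := {
  cmul : A -> A -> A;
  cstar : A -> A;
  cmulA : forall x y z, cmul x (cmul y z) = cmul (cmul x y) z;
  cmulDl : forall x y z, cmul (x + y) z = cmul x z + cmul y z;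
  cmulDr : forall x y z, cmul x (y + z) = cmul x y + cmul x z;
  cmulZl : forall (c : R[i]) x y, cmul (c *: x) y = c *: cmul x y;
  cmulZr : forall (c : R[i]) x y, cmul x (c *: y) = c *: cmul x y;
  cstarK : forall x, cstar (cstar x) = x;
  cstarD : forall x y, cstar (x + y) = cstar x + cstar y;
  cstarZ : forall (c : R[i]) x, cstar (c *: x) = c^* *: cstar x;
  cstarM : forall x y, cstar (cmul x y) = cmul (cstar y) (cstar x);
  cnormM : forall x y, `|cmul x y| <= `|x| * `|y|;
  cnormS : forall x, `|cmul (cstar x) x| = `|x| ^+ 2
}.

#[short(type="cstarAlgType")]
HB.structure Definition CStarAlgebra (R : realType) :=
  { A of CompleteNormedModule R[i] A & isCStarAlgebra R A }.

Notation "x ** y" := (cmul x y) (at level 40, left associativity) : ring_scope.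

Section CStarTheory.
Context {R : realType}.
Local Notation C := (Cplx R).

(* Supremum in [0, +oo]: the supremum of the empty set is 0, not -oo. *)
Definition nnsup (S : set (\bar R)) : \bar R := ereal_sup (0%E |` S).

Definition rnorm (V : normedModType R[i]) (x : V) : R := complex.Re `|x|.

Context (A : cstarAlgType R).
Implicit Types (a b : A) (u v : A * C) (M : set A) (phi psi : A -> C).

Definition selfadj : set A := [set a | cstar a = a].

Definition positive : set A := [set a | exists b, a = cstar b ** b].

Definition is_unit (e : A) := forall a, e ** a = a /\ a ** e = a.

Definition unital := exists e : A, is_unit e.

(* A pair [(a, l)] stands for [a + l 1]; when [A] is unital,
    [A] itself is the set of the pairs [(a, 0)], so that [uA] is [A] if [A]
    is unital and [A (+) C] otherwise. *)
Definition uA : set (A * C) := [set u | unital -> u.2 = 0].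

Definition uone : A * C :=
  if `[< unital >] then (xget 0 is_unit, 0) else (0, 1).

(* [A] is an ideal of [uA]: the product of [u] in [uA] with [b] in [A]. *)
Definition umul u b : A := u.1 ** b + u.2 *: b.

(* The C*-norm of [uA]: the norm of the left multiplication operator on [A]. *)
Definition unorm u : R := sup [set rnorm (umul u b) | b in [set b | `|b| <= 1]].

Definition usa : set (A * C) :=
  [set u | [/\ uA u, cstar u.1 = u.1 & (u.2 : R[i])^* = u.2]].

Definition states : set {ptws A -> C} :=
  [set phi | [/\ linear (phi : A -> C),
     (forall a, 0 <= phi (cstar a ** a)) &
     nnsup [set (rnorm (phi a))%:E | a in [set a | `|a| <= 1]] = 1%E]].

Definition uext phi u : C := phi u.1 + u.2.

(* A seminorm defined on a subspace of [usa] is extended by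
    +oo outside of its domain. *)

Definition Ldom (L : A * C -> \bar R) : set (A * C) :=
  [set u | usa u /\ (L u < +oo)%E].

Definition lipschitz_pair (L : A * C -> \bar R) :=
  [/\ [/\ (forall u, usa u -> (0 <= L u)%E),
          (forall u v, usa u -> usa v -> (L (u + v)%R <= L u + L v)%E) &
          (forall (t : R) u, Ldom L u -> L (t%:C *: u)%R = (`|t|%:E * L u)%E)],
      (forall u (e : R), usa u -> 0 < e ->
         exists2 v, Ldom L v & unorm (u - v) < e) &
      [set u | usa u /\ L u = 0%E] = [set t%:C *: uone | t in [set: R]]].

(* [L (a + l 1) = L a]; in the unital case this only reads [L] on [A]. *)
Definition unit_ext (L : A -> \bar R) : A * C -> \bar R := fun u => L u.1.

Definition mk (L : A * C -> \bar R) phi psi : \bar R :=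
  nnsup [set (rnorm (phi a - psi a))%:E |
         a in [set a | selfadj a /\ (L (a, 0%R) <= 1)%E]].

Definition lip1 (L : A * C -> \bar R) phi : set (A * C) :=
  [set u | [/\ usa u, (L u <= 1)%E & uext phi u = 0]].

Definition abelian_cstar_subalg M :=
  [/\ [/\ M 0, (forall a b, M a -> M b -> M (a + b)) &
          (forall (c : R[i]) a, M a -> M (c *: a))],
      (forall a b, M a -> M b -> M (a ** b)),
      (forall a, M a -> M (cstar a)),
      closed M &
      (forall a b, M a -> M b -> a ** b = b ** a)].

(* An increasing net of positive elements of the unit ball. *)
Definition has_approx_identity M :=
  exists (I : Type) (le : I -> I -> Prop) (e : I -> A),
  [/\ [/\ inhabited I, (forall i, le i i),
          (forall i j k, le i j -> le j k -> le i k) &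
          (forall i j, exists2 k, le i k & le j k)],
      (forall i, [/\ M (e i), positive (e i) & `|e i| <= 1]),
      (forall i j, le i j -> positive (e j - e i)) &
      (forall a (d : R), 0 < d -> exists i, forall j, le i j ->
         rnorm (e j ** a - a) < d /\ rnorm (a ** e j - a) < d)].

Definition topographic M := abelian_cstar_subalg M /\ has_approx_identity M.

Section Spectrum.
Context (M : set A).

(* The Gel'fand spectrum of [M], with the topology of pointwise convergence. *)
Definition spectrum : set {ptws M -> C} :=
  [set x | [/\ (exists f : M, x f != 0),
     (forall (c : R[i]) (f g h : M),
        val h = c *: val f + val g -> x h = c * x f + x g) &
     (forall f g h : M, val h = val f ** val g -> x h = x f * x g)]].

Definition compacts : set (set {ptws M -> C}) :=
  [set K | compact K /\ K `<=` spectrum].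

Definition compacts_dir : set_system (set {ptws M -> C}) :=
  filter_from compacts (fun K => [set K' | compacts K' /\ K `<=` K']).

(* The elements of [M] whose Gel'fand transform [x |-> x f] is everywhere
   above the indicator function of [K]. *)
Definition majorants (K : set {ptws M -> C}) : set M :=
  [set f | forall x, spectrum x -> 0 <= x f /\ (K x -> 1 <= x f)].

Definition majorants_dir (K : set {ptws M -> C}) : set_system M :=
  filter_from (majorants K)
    (fun g => [set f | majorants K f /\ forall x, spectrum x -> x f <= x g]).

(* The indicator function of a compact set [K], as an element of the bidual
   [M**]: it is upper semicontinuous, hence is the infimum, and the weak*
   limit, of the decreasing net of the elements of [M] above it. If [psi] is a
   positive functional on [M], then [indicator K psi] is the infimum of the
   [psi f] for [f] above [K], that is, the mass of [K] for the Radon measure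
   of [psi]. *)
Definition indicator (K : set {ptws M -> C}) (psi : M -> C) : C :=
  lim (psi f @[f --> majorants_dir K]).

(* The enveloping von Neumann algebra [A**] is the bidual of [A], with the
    Arens product. The normal extension of a functional [psi] to [A**] is
    the evaluation [F |-> F psi]. *)

Definition arens (F G : (A -> C) -> C) : (A -> C) -> C :=
  fun psi => F (fun a => G (fun b => psi (a ** b))).

(* The Arens product of [u] in [uA], seen in [A**], with [G]. *)
Definition uarens u (G : (A -> C) -> C) : (A -> C) -> C :=
  fun psi => G (fun b => psi (umul u b)).

(* The inclusion of [M**] in [A**]. *)
Definition bidual_incl (F : (M -> C) -> C) : (A -> C) -> C :=
  fun psi => F (fun f : M => psi (val f)).

Definition chi (K : set {ptws M -> C}) : (A -> C) -> C :=
  bidual_incl (indicator K).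

Definition compression (K : set {ptws M -> C}) u : (A -> C) -> C :=
  arens (chi K) (uarens u (chi K)).

Definition states_on (K : set {ptws M -> C}) : set {ptws A -> C} :=
  [set phi | states phi /\ chi K phi = 1].

Definition local_states : set {ptws A -> C} :=
  \bigcup_(K in compacts) states_on K.

End Spectrum.

Definition lipschitz_triple (L : A * C -> \bar R) M :=
  lipschitz_pair L /\ topographic M.

Definition regular_triple (L : A * C -> \bar R) M :=
  lipschitz_triple L M /\
  forall K, compacts (M := M) K ->
    (nnsup [set mk L phi psi | phi in states_on K & psi in states_on K]
       < +oo)%E.

Definition tame (L : A * C -> \bar R) M (S : set {ptws A -> C}) :=
  S `<=` states /\
  exists2 mu, local_states M mu &
    (nnsup [set (rnorm (uext phi u - compression K u phi))%:E |
            u in lip1 L mu & phi in S])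
      @[K --> compacts_dir (M := M)] --> 0%E.

Definition mk_open (L : A * C -> \bar R) (S U : set {ptws A -> C}) :=
  forall phi, U phi -> exists2 r : R, 0 < r &
    forall psi, S psi -> (mk L phi psi < r%:E)%E -> U psi.

Definition qlc_metric_space (L : A * C -> \bar R) M :=
  regular_triple L M /\
  forall S, tame L M S -> forall U, U `<=` S ->
    (mk_open L S U <-> exists2 V, open V & U = S `&` V).

End CStarTheory.

Section RealNorm.
Context {R : realType}.

Lemma rnormE (V : normedModType R[i]) (x : V) : (rnorm x)%:C = `|x|.
Proof. by apply: RRe_real; exact: normr_real. Qed.

Lemma rnorm_le (V W : normedModType R[i]) (x : V) (y : W) :
  (rnorm x <= rnorm y) = (`|x| <= `|y|).
Proof. by rewrite -lecR !rnormE. Qed.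

Lemma rnorm_ge0 (V : normedModType R[i]) (x : V) : 0 <= rnorm x.
Proof. by rewrite -lecR rnormE normr_ge0. Qed.

Lemma rnorm0 (V : normedModType R[i]) : rnorm (0 : V) = 0.
Proof. by apply: complexI; rewrite rnormE normr0. Qed.

Lemma rnorm_eq0 (V : normedModType R[i]) (x : V) : rnorm x = 0 -> x = 0.
Proof. by move=> x0; apply/normr0_eq0; rewrite -rnormE x0. Qed.

Lemma rnormD (V : normedModType R[i]) (x y : V) :
  rnorm (x + y) <= rnorm x + rnorm y.
Proof. by rewrite -lecR rmorphD/= !rnormE ler_normD. Qed.

Lemma rnormBC (V : normedModType R[i]) (x y : V) :
  rnorm (x - y) = rnorm (y - x).
Proof. by apply: complexI; rewrite !rnormE distrC. Qed.

Lemma rnormM (x y : Cplx R) : rnorm (x * y : Cplx R) = rnorm x * rnorm y.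
Proof. by apply: complexI; rewrite rmorphM/= !rnormE normrM. Qed.

Lemma rnormJ (x : R[i]) : rnorm (x^* : Cplx R) = rnorm (x : Cplx R).
Proof. by apply: complexI; rewrite !rnormE normcJ. Qed.

Lemma ltr_rnorm (V : normedModType R[i]) (x : V) (e : R) :
  (rnorm x < e) = (`|x| < e%:C).
Proof. by rewrite -ltcR rnormE. Qed.

Lemma ler_rnorm (V : normedModType R[i]) (x : V) (e : R) :
  (rnorm x <= e) = (`|x| <= e%:C).
Proof. by rewrite -lecR rnormE. Qed.

Lemma posC (e : R[i]) : 0 < e -> exists2 r : R, 0 < r & e = r%:C.
Proof.
move=> e0; exists (complex.Re e).
  by move: e0; rewrite ltcE => /andP[_].
by rewrite RRe_real// gtr0_real.
Qed.

Lemma cvg_rnormP (V : normedModType R[i]) T (F : set_system T) {FF : Filter F}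
    (f : T -> V) (l : V) :
  f @ F --> l <-> forall e : R, 0 < e -> \forall t \near F, rnorm (l - f t) < e.
Proof.
split=> [/cvgrPdist_lt fl e e0|fl].
  have eC : 0 < e%:C by rewrite ltcR.
  have := fl _ eC; apply: filterS => t; by rewrite ltr_rnorm.
apply/cvgrPdist_lt => _/posC[e e0 ->].
have := fl _ e0; apply: filterS => t; by rewrite ltr_rnorm.
Qed.

Lemma cauchy_rnormP (V : normedModType R[i]) (F : set_system V)
    {FF : ProperFilter F} :
  cauchy F <-> forall e : R, 0 < e -> exists x : V, F [set y | rnorm (x - y) < e].
Proof.
split=> [/cauchyP Fc e e0|Fc].
  have eC : 0 < e%:C by rewrite ltcR.
  have [x Fx] := Fc _ eC; exists x; apply: filterS Fx => y.
  by rewrite -ball_normE/= ltr_rnorm.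
apply/cauchyP => _/posC[e e0 ->].
have [x Fx] := Fc _ e0; exists x; apply: filterS Fx => y.
by rewrite -ball_normE/= ltr_rnorm.
Qed.

Lemma rnorm_continuous (V : normedModType R[i]) : continuous (@rnorm R V).
Proof.
move=> x; apply/cvgrPdist_lt => e e0.
have /cvg_rnormP/(_ _ e0) : id y @[y --> x] --> x by exact: cvg_id.
apply: filterS => y; apply: le_lt_trans.
have := rnormD (x - y) y; have := rnormD (y - x) x.
rewrite !subrK (rnormBC y) ler_norml => h1 h2.
by apply/andP; split; lra.
Qed.

Lemma Cplx_complete (F : set_system (Cplx R)) :
  ProperFilter F -> cauchy F -> cvg F.
Proof.
move=> FF /cauchy_rnormP Fc.
have h (p : Cplx R -> R) : (forall x y, `|p x - p y| <= rnorm (x - y)) ->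
    cvg (p @ F).
  move=> hp; apply: R_complete; apply/cauchyP => e e0.
  have [x Fx] := Fc _ e0; exists (p x).
  suff H : [set y | rnorm (x - y) < e] `<=` p @^-1` ball (p x) e.
    exact: filterS H Fx.
  by move=> y /(le_lt_trans (hp x y)); rewrite -ball_normE.
have hRe x y : `|complex.Re x - complex.Re y| <= rnorm (x - y : Cplx R).
  by rewrite -lecR rnormE -raddfB; exact: normc_ge_Re.
have hIm x y : `|complex.Im x - complex.Im y| <= rnorm (x - y : Cplx R).
  rewrite -lecR rnormE -raddfB normc_def lecR -sqrtr_sqr ler_wsqrtr//.
  by rewrite lerDr sqr_ge0.
have /cvg_ex[a ha] := h _ hRe; have /cvg_ex[b hb] := h _ hIm.
apply/cvg_ex; exists (a +i* b); apply/cvg_rnormP => e e0.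
have e20 : 0 < e / 2 by rewrite divr_gt0.
have /cvgrPdist_lt/(_ _ e20) h1 := ha.
have /cvgrPdist_lt/(_ _ e20) h2 := hb.
apply: filterS (filterI h1 h2) => z [z1 z2].
rewrite ltr_rnorm.
have -> : a +i* b - z = (a - complex.Re z)%:C + 'i%C * (b - complex.Im z)%:C :> R[i].
  by case: z {z1 z2} => c d; simpc.
apply: (le_lt_trans (ler_normD _ _)).
rewrite normrM [`|'i%C|](_ : _ = 1); last first.
  by rewrite normc_def/= expr0n add0r expr1n sqrtr1.
rewrite mul1r !normc_def/= !expr0n/= !addr0 !sqrtr_sqr -rmorphD/= ltcR; lra.
Qed.

End RealNorm.

Section C0.
Context {R : realType} {X : topologicalType}.
Local Notation C := (Cplx R).

Definition vanishes_at_infinity (f : X -> C) :=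
  forall e : R, 0 < e -> compact [set x | e <= rnorm (f x)].

Definition c0_pred : {pred X -> C} :=
  mem [set f : X -> C | continuous f /\ vanishes_at_infinity f].

Record C0 := MkC0 { c0_fun :> X -> C; c0_prop : c0_fun \in c0_pred }.

Lemma c0_closed_ge (f : X -> C) (e : R) : continuous f ->
  closed [set x | e <= rnorm (f x)].
Proof.
move=> cf; apply: (@closed_comp _ _ (fun x => rnorm (f x)) [set y | e <= y]).
  by move=> x _; apply: continuous_comp; [exact: cf|exact: rnorm_continuous].
exact: closed_ge.
Qed.

Lemma c0_dom (f : X -> C) : continuous f ->
  (forall e, 0 < e -> exists2 K, compact K &
     forall x, e <= rnorm (f x) -> K x) -> vanishes_at_infinity f.
Proof.
move=> cf fK e e0; have [K cK eK] := fK _ e0.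
by apply: (subclosed_compact _ cK) => //; exact: c0_closed_ge.
Qed.

Lemma c0_submod_closed : submod_closed c0_pred.
Proof.
split.
  rewrite inE; split; first exact: cst_continuous.
  move=> e e0; rewrite [X in compact X](_ : _ = set0); first exact: compact0.
  by apply/seteqP; split => x //=; rewrite rnorm0 leNgt e0.
move=> a f g; rewrite !inE => -[cf vf] [cg vg].
have ch : continuous (a *: f + g).
  move=> x; apply: (@cvgD _ C _ (nbhs x) _ (fun x => a *: f x) g); last exact: cg.
  by apply: (@cvgZl_tmp _ C _ (nbhs x)); exact: cf.
split=> //.
pose K (e : R) := [set x | e / 2 / (1 + rnorm (a : C)) <= rnorm (f x)] `|`
                  [set x | e / 2 <= rnorm (g x)].
have a1 : 0 < 1 + rnorm (a : C) by rewrite ltr_pwDl// rnorm_ge0.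
apply: c0_dom => // e e0; exists (K e) => [|x eh].
  by apply: compactU; [apply: vf|apply: vg]; rewrite !divr_gt0.
have [|ge] := leP (e / 2) (rnorm (g x)); [by right|left].
rewrite /= ler_pdivrMr//.
have : rnorm ((a *: f + g) x) <= rnorm (a : C) * rnorm (f x) + rnorm (g x).
  by rewrite -rnormM; exact: rnormD.
have := rnorm_ge0 (f x); nra.
Qed.

HB.instance Definition _ := GRing.isSubmodClosed.Build _ _ c0_pred
  c0_submod_closed.

HB.instance Definition _ := [isSub for c0_fun].
HB.instance Definition _ := [Choice of C0 by <:].
HB.instance Definition _ := [SubChoice_isSubLmodule of C0 by <:].

Implicit Types f g h : C0.

Lemma c0P f : continuous f /\ vanishes_at_infinity f.
Proof. by have := c0_prop f; rewrite inE. Qed.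

Lemma c0_eqP f g : f =1 g -> f = g.
Proof. by move=> fg; apply/val_inj/funext. Qed.

Definition supnorm f : R := sup (range (fun x => rnorm (f x))).

Lemma supnorm_has_ubound f : has_ubound (range (fun x => rnorm (f x))).
Proof.
have [cf vf] := c0P f.
have c1 : compact ((fun x => rnorm (f x)) @` [set x | 1 <= rnorm (f x)]).
  apply: continuous_compact; last exact: vf.
  apply: continuous_subspaceT => x.
  by apply: continuous_comp; [exact: cf|exact: rnorm_continuous].
have [M [_ hM]] := compact_bounded c1.
have {}hM : globally ((fun x => rnorm (f x)) @` [set x | 1 <= rnorm (f x)])
    (fun y : R => `|y| <= M + 1) by apply: hM; rewrite ltrDl.
exists (Num.max 1 (M + 1)) => _ [x _ <-]; rewrite le_max.
have [|/ltW fx] := leP (rnorm (f x)) 1; [by []|rewrite orFb].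
by rewrite (le_trans (ler_norm _))//; apply: hM; exists x.
Qed.

Lemma supnorm_ge f x : rnorm (f x) <= supnorm f.
Proof. by apply: ub_le_sup; [exact: supnorm_has_ubound|exists x]. Qed.

Lemma supnorm_le f (c : R) : 0 <= c -> (forall x, rnorm (f x) <= c) ->
  supnorm f <= c.
Proof.
move=> c0 fc; rewrite /supnorm.
have [->|/set0P ne] := eqVneq (range (fun x => rnorm (f x))) set0.
  by rewrite sup0.
by apply: ge_sup => // _ [x _ <-].
Qed.

Lemma supnorm_ge0 f : 0 <= supnorm f.
Proof.
rewrite /supnorm.
have [->|/set0P[_ [x _ _]]] := eqVneq (range (fun x => rnorm (f x))) set0.
  by rewrite sup0.
exact: le_trans (rnorm_ge0 (f x)) (supnorm_ge f x).
Qed.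

Let nrm f : R[i] := (supnorm f)%:C.

Let nrmD f g : nrm (f + g) <= nrm f + nrm g.
Proof.
rewrite -rmorphD/= lecR; apply: supnorm_le => [|x].
  by rewrite addr_ge0// supnorm_ge0.
by apply: (le_trans (rnormD _ _)); rewrite lerD// supnorm_ge.
Qed.

Let nrmZ (c : R[i]) f : nrm (c *: f) = `|c| * nrm f.
Proof.
rewrite -[`|c|](@rnormE _ C) -rmorphM/=; congr _%:C.
have [->|c0] := eqVneq c 0.
  rewrite rnorm0 mul0r; apply/eqP; rewrite eq_le supnorm_ge0 andbT.
  by apply: supnorm_le => // x; rewrite [_ x]mul0r rnorm0.
have nc : 0 < rnorm (c : C).
  by rewrite lt_neqAle rnorm_ge0 andbT eq_sym; apply: contra c0 => /eqP/rnorm_eq0 ->.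
apply/eqP; rewrite eq_le; apply/andP; split.
  apply: supnorm_le => [|x]; first by rewrite mulr_ge0// ?supnorm_ge0// ltW.
  by rewrite [_ x]/(c * _) rnormM ler_wpM2l ?rnorm_ge0// supnorm_ge.
rewrite mulrC -ler_pdivlMr//; apply: supnorm_le => [|x].
  by rewrite divr_ge0 ?rnorm_ge0 ?supnorm_ge0.
by rewrite ler_pdivlMr// mulrC -rnormM; exact: (supnorm_ge (c *: f)).
Qed.

Let nrm0 f : nrm f = 0 -> f = 0.
Proof.
move=> /complexI f0; apply: c0_eqP => x; apply: rnorm_eq0.
by apply/eqP; rewrite eq_le rnorm_ge0 andbT -f0 supnorm_ge.
Qed.

HB.instance Definition _ := Lmodule_isNormed.Build R[i] C0 nrmD nrmZ nrm0.

Lemma c0_normE f : `|f| = (supnorm f)%:C. Proof. by []. Qed.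

Lemma c0_complete (F : set_system C0) : ProperFilter F -> cauchy F -> cvg F.
Proof.
move=> FF /cauchy_rnormP Fc.
have hC (e : R) : 0 < e -> exists f, F [set g | forall x, rnorm (f x - g x) < e].
  move=> /Fc[f Ff]; exists f; apply: filterS Ff => g fg x.
  exact: le_lt_trans (supnorm_ge (f - g) x) fg.
have /choice[l hl] x : exists l : C, g x @[g --> F] --> l.
  apply/cvg_ex; apply: Cplx_complete; apply/cauchy_rnormP => e e0.
  have [f Ff] := hC _ e0; exists (f x).
  suff H : [set g : C0 | forall x, rnorm (f x - g x) < e] `<=`
      (fun g : C0 => g x) @^-1` [set y : C | rnorm (f x - y) < e].
    exact: filterS H Ff.
  by move=> g /(_ x).
have hu (e : R) : 0 < e -> F [set g | forall x, rnorm (l x - g x) <= e].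
  move=> e0; have e20 : 0 < e / 2 by rewrite divr_gt0.
  have [f Ff] := hC _ e20; apply: filterS (Ff) => g fg x.
  apply/ler_addgt0Pr => d d0; have /cvg_rnormP/(_ _ d0) hd := hl x.
  have [h [/(_ x) fh lh]] := filter_ex (filterI Ff hd).
  have := rnormD (l x - h x) (h x - g x); rewrite addrA subrK.
  have := rnormD (h x - f x) (f x - g x); rewrite addrA subrK.
  by move: (fg x) fh; rewrite (rnormBC (f x) (h x)); lra.
have lc : continuous l.
  move=> x; apply/cvg_rnormP => e e0.
  have e40 : 0 < e / 4 by rewrite divr_gt0.
  have [g hg] := filter_ex (hu _ e40); have [cg _] := c0P g.
  have /cvg_rnormP/(_ _ e40) := cg x; apply: filterS => y gxy.
  have := rnormD (l x - g x) (g x - g y); rewrite addrA subrK.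
  have := rnormD (l x - g y) (g y - l y); rewrite addrA subrK.
  by have := hg x; have := hg y; rewrite (rnormBC (l y)); lra.
have lv : vanishes_at_infinity l.
  apply: c0_dom => // e e0; have e20 : 0 < e / 2 by rewrite divr_gt0.
  have [g hg] := filter_ex (hu _ e20); have [_ vg] := c0P g.
  exists [set x | e / 2 <= rnorm (g x)]; first exact: vg.
  move=> x /=; have := rnormD (l x - g x) (g x); rewrite subrK.
  by have := hg x; lra.
have lP : l \in c0_pred by rewrite inE.
apply/cvg_ex; exists (MkC0 lP); apply/cvgrPdist_le => _/posC[e e0 ->].
apply: filterS (hu _ e0) => g lg.
by rewrite c0_normE lecR; apply: supnorm_le => // ; exact: ltW.
Qed.

HB.instance Definition _ := Uniform_isComplete.Build C0 c0_complete.

Let mul_subproof f g : (fun x => f x * g x : C) \in c0_pred.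
Proof.
have [[cf vf] [cg vg]] := (c0P f, c0P g); rewrite inE.
have cfg : continuous (fun x => f x * g x : C).
  by move=> x; apply: (@cvgM _ _ (nbhs x)); [exact: cf|exact: cg].
split=> //; apply: c0_dom => // e e0.
have g1 : 0 < 1 + supnorm g by rewrite ltr_pwDl// supnorm_ge0.
exists [set x | e / (1 + supnorm g) <= rnorm (f x)].
  by apply: vf; rewrite divr_gt0.
move=> x /=; rewrite rnormM ler_pdivrMr//; have := supnorm_ge g x.
by have := rnorm_ge0 (f x); nra.
Qed.

Let star_subproof f : (fun x => (f x : R[i])^* : C) \in c0_pred.
Proof.
have [cf vf] := c0P f; rewrite inE.
split=> [x|e e0]; last first.
  rewrite [X in compact X](_ : _ = [set x | e <= rnorm (f x)]); first exact: vf.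
  by apply/seteqP; split => x /=; rewrite rnormJ.
apply/cvg_rnormP => e e0.
have /cvg_rnormP/(_ _ e0) := cf x; apply: filterS => y.
by rewrite -rmorphB rnormJ.
Qed.

Definition c0_mul f g : C0 := MkC0 (mul_subproof f g).
Definition c0_star f : C0 := MkC0 (star_subproof f).

Let c0_mulA f g h : c0_mul f (c0_mul g h) = c0_mul (c0_mul f g) h.
Proof. by apply: c0_eqP => x /=; rewrite mulrA. Qed.
Let c0_mulDl f g h : c0_mul (f + g) h = c0_mul f h + c0_mul g h.
Proof. by apply: c0_eqP => x /=; exact: mulrDl. Qed.
Let c0_mulDr f g h : c0_mul f (g + h) = c0_mul f g + c0_mul f h.
Proof. by apply: c0_eqP => x /=; exact: mulrDr. Qed.
Let c0_mulZl (c : R[i]) f g : c0_mul (c *: f) g = c *: c0_mul f g.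
Proof. by apply: c0_eqP => x /=; rewrite [LHS]mulrC [RHS]mulrA [RHS]mulrC. Qed.
Let c0_mulZr (c : R[i]) f g : c0_mul f (c *: g) = c *: c0_mul f g.
Proof. by apply: c0_eqP => x /=; exact: mulrCA. Qed.
Let c0_starK f : c0_star (c0_star f) = f.
Proof. by apply: c0_eqP => x /=; exact: conjcK. Qed.
Let c0_starD f g : c0_star (f + g) = c0_star f + c0_star g.
Proof. by apply: c0_eqP => x; exact: rmorphD. Qed.
Let c0_starZ (c : R[i]) f : c0_star (c *: f) = c^* *: c0_star f.
Proof. by apply: c0_eqP => x; exact: rmorphM. Qed.
Let c0_starM f g : c0_star (c0_mul f g) = c0_mul (c0_star g) (c0_star f).
Proof. by apply: c0_eqP => x; rewrite /= rmorphM mulrC. Qed.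
Let c0_normM f g : `|c0_mul f g| <= `|f| * `|g|.
Proof.
rewrite !c0_normE -rmorphM/= lecR; apply: supnorm_le => [|x].
  by rewrite mulr_ge0// supnorm_ge0.
by rewrite rnormM ler_pM ?rnorm_ge0// supnorm_ge.
Qed.
Let c0_normS f : `|c0_mul (c0_star f) f| = `|f| ^+ 2.
Proof.
rewrite !c0_normE -rmorphXn/=; congr _%:C; apply/eqP; rewrite eq_le.
apply/andP; split.
  apply: supnorm_le => [|x]; first by rewrite exprn_ge0// supnorm_ge0.
  by rewrite rnormM rnormJ expr2 ler_pM ?rnorm_ge0// supnorm_ge.
set h := c0_mul _ _.
have -> : supnorm h = (Num.sqrt (supnorm h)) ^+ 2.
  by rewrite sqr_sqrtr// supnorm_ge0.
rewrite ler_sqr ?nnegrE ?supnorm_ge0 ?sqrtr_ge0//.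
apply: supnorm_le => [|x]; first exact: sqrtr_ge0.
rewrite -ler_sqr ?nnegrE ?rnorm_ge0 ?sqrtr_ge0// sqr_sqrtr ?supnorm_ge0//.
by apply: le_trans (supnorm_ge h x); rewrite rnormM rnormJ expr2.
Qed.

HB.instance Definition _ := isCStarAlgebra.Build R C0
  c0_mulA c0_mulDl c0_mulDr c0_mulZl c0_mulZr
  c0_starK c0_starD c0_starZ c0_starM c0_normM c0_normS.

End C0.
Arguments C0 R X : clear implicits.

Definition Lip {R : realType} {X : metricType R} (f : C0 R X) : \bar R :=
  nnsup [set (rnorm (f p.1 - f p.2) / mdist p.1 p.2)%:E |
         p in [set p : X * X | p.1 <> p.2]].

(* Main.v *)
From HB Require Import structures.
Require Import Defs.
From mathcomp Require Import all_boot all_order all_algebra.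
From mathcomp Require Import ring lra complex.
From mathcomp Require Import all_classical all_reals all_analysis.

Set Implicit Arguments.
Unset Strict Implicit.
Unset Printing Implicit Defensive.

Import Order.TTheory GRing.Theory Num.Theory numFieldNormedType.Exports.

Local Open Scope classical_set_scope.
Local Open Scope complex_scope.
Local Open Scope ring_scope.

(** Everything is translated to real-valued functions on [X]. By the Gel'fand
    theorem the spectrum of [C0(X)] is [X], so a compact set [K] of characters
    lies inside the evaluations at the points of a compact subset of [X], and
    the indicator function of [K] is the decreasing limit of the functions of
    [C0(X)] above it. A state extends to a positive normalized functional
    [mean] on [C0(X) + R], and the only thing that has to be known about the
    Arens product [chi_K u chi_K] is that its value at a state is at most the
    mean of [w k^2], for [w >= 0] the function of [u] and [k] any function above
    [K] ([compression_le]).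

    Regularity holds because a state carried by [K] gives mean at least 1 to a
    bump [k] supported in a ball of radius [r] around [x0]; the mean of a
    1-Lipschitz function [f] then differs from [f x0] by at most [r]
    ([mean_localized]), whence the diameter is at most [2 r].

    That small Monge-Kantorovich distance forces weak* closeness is true on all
    states: a function of [C0(X)] is a uniform limit of Lipschitz ones
    ([lip_approx]), which the distance controls up to a factor.

    The converse, on a tame set, has two parts. First, tameness is a uniform
    tightness ([tame_uniform]): for every [e] there is one compactly supported
    [k] with [0 <= k <= 1] such that the mean of [w] is [e]-close to that of
    [w k], for all states of the set and all 1-Lipschitz [w] of mean zero under
    the reference state [mu]. Tameness only bounds signed means outside of [K];
    it is applied to two nonnegative functions that vanish where [mu] lives,
    namely a multiple of [1 - k0] for a bump [k0], which bounds the mass outside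
    of [K], and the positive part of [|w| - 2 r], which then bounds the mean of
    [|w|] there. Second, the 1-Lipschitz functions with a given bound at one
    point are compact for pointwise convergence, by Tychonoff's theorem, and
    there pointwise convergence is uniform on the support of [k]; hence the
    means of all the [w k] vary little when the state varies little in the
    weak* topology ([near_states]). *)

(** * Real-valued functions vanishing at infinity *)

Section RealFunctions.
Context {R : realType} {X : topologicalType}.
Local Notation C := (Cplx R).
Local Notation A := (C0 R X).
Implicit Types (f g : X -> R) (a b : A).

Lemma rnorm_real (t : R) : rnorm (t%:C : C) = `|t|.
Proof. by apply: complexI; rewrite rnormE normc_def/= expr0n addr0 sqrtr_sqr. Qed.

Lemma Re_le_rnorm (z : C) : `|complex.Re z| <= rnorm z.
Proof. by rewrite -lecR rnormE; exact: normc_ge_Re. Qed.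

Lemma rnorm_le_ReIm (z : C) : rnorm z <= `|complex.Re z| + `|complex.Im z|.
Proof.
rewrite -lecR rnormE {1}(complexE z) (le_trans (ler_normD _ _))//.
rewrite normrM [`|'i%C|](_ : _ = 1); last first.
  by rewrite normc_def/= expr0n add0r expr1n sqrtr1.
by rewrite mul1r !normc_def/= !expr0n/= !addr0 !sqrtr_sqr -rmorphD lecR.
Qed.

Lemma real_complex_continuous : continuous (fun t : R => t%:C : C).
Proof.
move=> t; apply/cvg_rnormP => e e0.
have /cvgrPdist_lt/(_ _ e0) : id s @[s --> t] --> t by exact: cvg_id.
by apply: filterS => s; rewrite -rmorphB rnorm_real.
Qed.

Lemma near_rnorm_lt (z : C) (e : R) : 0 < e ->
  \forall y \near z, rnorm (z - y : C) < e.
Proof.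
exact: ((@cvg_rnormP R C _ (nbhs z) (@nbhs_filter _ z) id z).1 (@cvg_id _ (nbhs z)) e).
Qed.

Lemma Re_continuous : continuous (fun z : C => complex.Re z).
Proof.
move=> z; apply/(@cvgrPdist_lt _ _ _ _ (@nbhs_filter _ z)) => e e0.
apply: (@filterS _ (nbhs z) (@nbhs_filter _ z) _ _ _ (@near_rnorm_lt z e e0)) => y /=; apply: le_lt_trans.
by rewrite -raddfB; exact: Re_le_rnorm.
Qed.

Definition isC0 f :=
  continuous f /\ forall e : R, 0 < e -> compact [set x | e <= `|f x|].

Lemma isC0_pred f : isC0 f -> (fun x => (f x)%:C : C) \in c0_pred.
Proof.
move=> [cf vf]; rewrite inE; split.
  by move=> x; apply: continuous_comp; [exact: cf|exact: real_complex_continuous].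
move=> e e0; rewrite [X in compact X](_ : _ = [set x | e <= `|f x|]).
  exact: vf.
by apply/seteqP; split => x /=; rewrite rnorm_real.
Qed.

(** Total, with the junk value 0, so that no proof of continuity has to be
    carried in the terms. *)
Definition rC0 f : A :=
  if pselect ((fun x => (f x)%:C : C) \in c0_pred) is left h then MkC0 h else 0.

Lemma rC0E f x : isC0 f -> rC0 f x = (f x)%:C.
Proof. by move=> /isC0_pred fC; rewrite /rC0; case: pselect. Qed.

Lemma closed_normr_ge f (e : R) : continuous f -> closed [set x | e <= `|f x|].
Proof.
move=> cf; apply: (@preimage_closed _ _ (fun x => `|f x|) [set y | e <= y]).
  move=> x _; apply: (@continuous_comp _ _ _ f); first exact: cf.
  exact: norm_continuous.
exact: closed_ge.
Qed.

Lemma isC0_dom f (h : X -> R) : continuous f -> isC0 h ->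
  (forall x, `|f x| <= `|h x|) -> isC0 f.
Proof.
move=> cf [ch vh] fh; split => // e e0.
apply: (subclosed_compact _ (vh _ e0)); first exact: closed_normr_ge.
by move=> x /= ef; exact: le_trans (fh x).
Qed.

Lemma isC0_support f (K : set X) : continuous f -> compact K ->
  (forall x, ~ K x -> f x = 0) -> isC0 f.
Proof.
move=> cf cK fK; split => // e e0; apply: (subclosed_compact _ cK); first exact: closed_normr_ge.
move=> x /= ef; apply: contrapT => /fK fx.
by move: ef; rewrite fx normr0 leNgt e0.
Qed.

Lemma isC0_Re a : isC0 (fun x => complex.Re (a x)).
Proof.
have [ca va] := c0P a; have cR : continuous (fun x => complex.Re (a x)).
  by move=> x; apply: continuous_comp; [exact: ca|exact: Re_continuous].
split=> // e e0; apply: (subclosed_compact _ (va _ e0)).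
  exact: closed_normr_ge.
by move=> x /=; move/le_trans; apply; exact: Re_le_rnorm.
Qed.

Lemma isC0_Im a : isC0 (fun x => complex.Im (a x)).
Proof.
rewrite [X in isC0 X](_ : _ = fun x => complex.Re ((- 'i%C *: a : A) x)).
  exact: isC0_Re.
apply/funext => x; change (complex.Im (a x) = complex.Re (- 'i%C * a x)).
by case: (a x) => p q /=; lra.
Qed.

Lemma isC0_of a f : (forall x, a x = (f x)%:C) -> isC0 f.
Proof.
move=> af; rewrite [X in isC0 X](_ : _ = fun x => complex.Re (a x)).
  exact: isC0_Re.
by apply/funext => x; rewrite af.
Qed.

Lemma rC0_of a f : (forall x, a x = (f x)%:C) -> a = rC0 f.
Proof. by move=> af; apply: c0_eqP => x; rewrite rC0E ?af //; exact: (isC0_of af). Qed.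

Lemma rC0D f g : isC0 f -> isC0 g -> rC0 (f \+ g) = rC0 f + rC0 g.
Proof.
move=> f0 g0; apply/esym/rC0_of => x.
by rewrite [LHS]/(rC0 f x + rC0 g x) !rC0E//; exact/esym/(rmorphD (real_complex R)).
Qed.

Lemma rC0Z (t : R) f : isC0 f -> rC0 (t \*o f) = t%:C *: rC0 f.
Proof.
move=> f0; apply/esym/rC0_of => x.
by rewrite [LHS]/(t%:C * rC0 f x) rC0E//; exact/esym/(rmorphM (real_complex R)).
Qed.

Lemma rC0M f g : isC0 f -> isC0 g -> rC0 (f \* g) = rC0 f ** rC0 g.
Proof.
move=> f0 g0; apply/esym/rC0_of => x.
by rewrite [LHS]/(rC0 f x * rC0 g x) !rC0E//; exact/esym/(rmorphM (real_complex R)).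
Qed.

Lemma isC0D f g : isC0 f -> isC0 g -> isC0 (f \+ g).
Proof.
move=> f0 g0; apply: (@isC0_of (rC0 f + rC0 g)) => x.
by rewrite [LHS]/(rC0 f x + rC0 g x) !rC0E//; exact/esym/(rmorphD (real_complex R)).
Qed.

Lemma isC0Z (t : R) f : isC0 f -> isC0 (t \*o f).
Proof.
move=> f0; apply: (@isC0_of (t%:C *: rC0 f)) => x.
by rewrite [LHS]/(t%:C * rC0 f x) rC0E//; exact/esym/(rmorphM (real_complex R)).
Qed.

Lemma isC0M f g : isC0 f -> isC0 g -> isC0 (f \* g).
Proof.
move=> f0 g0; apply: (@isC0_of (rC0 f ** rC0 g)) => x.
by rewrite [LHS]/(rC0 f x * rC0 g x) !rC0E//; exact/esym/(rmorphM (real_complex R)).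
Qed.

Lemma c0_ReIm a : a = rC0 (fun x => complex.Re (a x)) +
   'i%C *: rC0 (fun x => complex.Im (a x)).
Proof.
apply: c0_eqP => x; rewrite [RHS]/(rC0 _ x + 'i%C * rC0 _ x)
  (rC0E _ (isC0_Re a)) (rC0E _ (isC0_Im a)).
exact: complexE.
Qed.

Lemma c0_selfadjP a : selfadj a <-> a = rC0 (fun x => complex.Re (a x)).
Proof.
split=> [sa|->].
  apply/rC0_of => x.
  have : cstar a x = a x by rewrite sa.
  rewrite [cstar a x]/((a x : R[i])^*).
  case: (a x) => p q /= [] hq; congr Complex; lra.
apply: c0_eqP => x; rewrite [LHS]/((rC0 _ x : R[i])^*) rC0E; last exact: isC0_Re.
exact: conjc_real.
Qed.

Lemma rC0_selfadj f : isC0 f -> selfadj (rC0 f).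
Proof.
move=> f0; apply: c0_eqP => x; rewrite [LHS]/((rC0 _ x : R[i])^*) rC0E//.
exact: conjc_real.
Qed.

Lemma supnorm_rC0_le f (c : R) : isC0 f -> 0 <= c -> (forall x, `|f x| <= c) ->
  supnorm (rC0 f) <= c.
Proof.
by move=> f0 c0 fc; apply: supnorm_le => // x; rewrite rC0E// rnorm_real.
Qed.

Lemma isC0_bounded f : isC0 f -> exists2 B : R, 0 <= B & forall x, `|f x| <= B.
Proof.
move=> f0; exists (supnorm (rC0 f)); first exact: supnorm_ge0.
by move=> x; have := supnorm_ge (rC0 f) x; rewrite rC0E// rnorm_real.
Qed.

Lemma isC0_sqrt f : isC0 f -> isC0 (fun x => Num.sqrt (f x)).
Proof.
move=> [cf vf]; have cs : continuous (fun x => Num.sqrt (f x)).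
  move=> x; apply: (@continuous_comp _ _ _ f); first exact: cf.
  exact: sqrt_continuous.
split=> // e e0; have e20 : 0 < e ^+ 2 by rewrite exprn_gt0.
apply: (subclosed_compact _ (vf _ e20)); first exact: closed_normr_ge.
move=> x /=; rewrite ger0_norm ?sqrtr_ge0// => ef.
have fx0 : 0 <= f x.
  rewrite leNgt; apply/negP => fx; move: ef.
  by rewrite ltr0_sqrtr// leNgt e0.
rewrite ger0_norm// -(sqr_sqrtr fx0) ler_sqr ?nnegrE ?sqrtr_ge0//.
exact: ltW.
Qed.

Lemma c0_positiveP a : positive a <-> forall x, 0 <= (a x : R[i]).
Proof.
split=> [[b ->] x|a0].
  by change (0 <= (b x : R[i])^* * (b x : R[i]) :> R[i]); rewrite mulrC mulcJ_ge0.
pose f x := complex.Re (a x); have f0 : isC0 f by exact: isC0_Re.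
have af x : a x = (f x)%:C by rewrite RRe_real// ger0_real.
have fge x : 0 <= f x by rewrite -lecR -af a0.
exists (rC0 (fun x => Num.sqrt (f x))); apply: c0_eqP => x.
rewrite [RHS]/((rC0 _ x : R[i])^* * rC0 _ x) rC0E; last exact: isC0_sqrt.
rewrite af -{1}(sqr_sqrtr (fge x)) expr2; apply/eqP; rewrite eq_complex /=.
by apply/andP; split; apply/eqP; lra.
Qed.

End RealFunctions.

(** * Lipschitz functions and bumps on a metric space *)

(** Convergence along this filter turns a local choice of compact sets into a
    single compact set: it is used with [compact_near_coveringP], where it does
    the work of a finite union over a subcover. *)
Definition compact_dir (T : topologicalType) : set_system (set T) :=
  filter_from (@compact T) (fun D => [set D' | compact D' /\ D `<=` D']).

#[local] Instance compact_dir_filter (T : topologicalType) :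
  Filter (@compact_dir T).
Proof.
apply: filter_from_filter; first by exists set0; exact: compact0.
move=> D1 D2 c1 c2; exists (D1 `|` D2); first exact: compactU.
by move=> D3 [c3 h3]; split; split=> // x hx; apply: h3; [left|right].
Qed.

Section MetricFunctions.
Context {R : realType} {X : metricType R}.
Implicit Types (f g h : X -> R) (D K : set X).

Definition lipr (n : R) f := forall x y, `|f x - f y| <= n * mdist x y.

Lemma liprP n f : (forall x y, f x <= f y + n * mdist x y) -> lipr n f.
Proof.
move=> fn x y; have := fn x y; have := fn y x.
by rewrite (metric_sym y x) ler_norml => h1 h2; apply/andP; split; lra.
Qed.

Lemma near_mdist (x : X) (e : R) : 0 < e -> \forall y \near x, mdist x y < e.
Proof.
move=> e0; have := nbhsx_ballx x e e0.
by apply: filterS => y; rewrite ballEmdist.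
Qed.

Lemma lipr_continuous n f : lipr n f -> continuous f.
Proof.
move=> fn x; apply/cvgrPdist_lt => e e0.
have n1 : 0 < `|n| + 1 by rewrite ltr_pwDr.
have e1 : 0 < e / (`|n| + 1) by rewrite divr_gt0.
apply: filterS (near_mdist x e1) => y; rewrite ltr_pdivlMr// => xy.
apply: le_lt_trans (fn x y) _; apply: le_lt_trans xy.
have := mdist_ge0 x y; have := ler_norm n; nra.
Qed.

(** The largest [n]-Lipschitz function below [h]. *)
Definition infconv (n : R) h x : R :=
  inf [set h y + n * mdist x y | y in [set: X]].

Section InfConvolution.
Context (n : R) (h : X -> R) (n0 : 0 <= n) (h0 : forall x, 0 <= h x).

Lemma infconv_lb x (c : R) : (forall y, c <= h y + n * mdist x y) ->
  c <= infconv n h x.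
Proof.
move=> hc; apply: lb_le_inf; first by exists (h x + n * mdist x x), x.
by move=> _ [y _ <-].
Qed.

Lemma infconv_le x y : infconv n h x <= h y + n * mdist x y.
Proof.
apply: ge_inf; last by exists y.
by exists 0 => _ [z _ <-]; rewrite addr_ge0// mulr_ge0// mdist_ge0.
Qed.

Lemma infconv_ge0 x : 0 <= infconv n h x.
Proof.
by apply: infconv_lb => y; rewrite addr_ge0// mulr_ge0// mdist_ge0.
Qed.

Lemma infconv_le_fun x : infconv n h x <= h x.
Proof. by have := infconv_le x x; rewrite mdistxx mulr0 addr0. Qed.

Lemma lipr_infconv : lipr n (infconv n h).
Proof.
apply: liprP => x y; rewrite -lerBlDr; apply: infconv_lb => z.
have := infconv_le x z; have := ler_wpM2l n0 (metric_triangle x y z).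
by rewrite mulrDr; lra.
Qed.

End InfConvolution.

(** The compact neighbourhoods of the points of [D] cover it, and finitely many
    of them are enough. *)
Lemma compact_nbhd D : locally_compact [set: X] -> compact D ->
  exists2 D', compact D' & forall x, D x -> nbhs x D'.
Proof.
move=> lc cD.
pose F := @compact_dir X.
have : \near F, D `<=` [set x | compact F /\ nbhs x F].
  apply: (compact_near_coveringP D).1 => // x _.
  have [B] := lc x I; rewrite withinET => xB [cB _].
  exists ([set x' | nbhs x' B], [set D2 | compact D2 /\ B `<=` D2]).
    by split; [exact: nbhs_interior|exists B].
  by move=> [x' D2] /= [x'B [c2 BD2]]; split => //; exact: filterS x'B.
move=> [D1 c1 hD1]; exists D1 => // x Dx.
by have [] := hD1 D1 (conj c1 (@subset_refl _ D1)) x Dx.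
Qed.

(** The inf-convolution of the indicator function of a compact neighbourhood
    [D] of [K], with a slope so steep that leaving [D] from a point of [K]
    costs at least 1. *)
Lemma bump K : locally_compact [set: X] -> compact K ->
  exists (k : X -> R) D n, [/\ compact D, 0 < n, lipr n k &
    forall x, [/\ 0 <= k x <= 1, K x -> k x = 1 & ~ D x -> k x = 0]].
Proof.
move=> lc cK; have [D cD KD] := compact_nbhd lc cK.
have [e e0 KeD] : exists2 e : R, 0 < e &
    forall x y, K x -> mdist x y < e -> D y.
  have : \forall e \near (0:R)^'+, K `<=` [set x | forall y, mdist x y < e -> D y].
    apply: (compact_near_coveringP K).1 => // x /KD/nbhs_ballP[d /= d0 xD].
    have d2 : 0 < d / 2 by rewrite divr_gt0.
    exists ([set y | mdist x y < d / 2], [set e | e < d / 2]).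
      by split => /=; [exact: near_mdist|exact: nbhs_right_lt].
    move=> [y e] /= [xy ed] z yz; apply: xD; rewrite ballEmdist /=.
    have := metric_triangle x y z; lra.
  move=> H; have : \forall e \near (0:R)^'+, 0 < e /\ (K `<=` [set x | forall y, mdist x y < e -> D y]).
    near=> e; split; first by near: e; exact: nbhs_right_gt.
    by near: e.
  by move=> /filter_ex [e [e0 he]]; exists e => // x y Kx; exact: he.
pose h x : R := if `[< D x >] then 1 else 0.
have h0 x : 0 <= h x by rewrite /h; case: ifP.
have h1 x : h x <= 1 by rewrite /h; case: ifP.
have n0 : 0 < e^-1 by rewrite invr_gt0.
exists (infconv e^-1 h), D, e^-1; split => //.
  by apply: lipr_infconv => //; exact: ltW.
move=> x; split.
- rewrite infconv_ge0 ?(ltW n0)//=.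
  by apply: le_trans (h1 x); apply: infconv_le_fun => //; exact: ltW.
- move=> Kx; apply/eqP; rewrite eq_le; apply/andP; split.
    by apply: le_trans (h1 x); apply: infconv_le_fun => //; exact: ltW.
  apply: infconv_lb => y; have [xy|xy] := ltP (mdist x y) e.
    rewrite /h asboolT; last exact: KeD xy.
    by rewrite lerDl mulr_ge0 ?mdist_ge0// ltW.
  rewrite -[leLHS]add0r lerD// ler_pdivlMl// mulr1.
  exact: xy.
- move=> nDx; apply/eqP; rewrite eq_le infconv_ge0 ?(ltW n0)// andbT.
  have := infconv_le_fun (ltW n0) h0 x; rewrite {2}/h; case: asboolP => //.
Unshelve. all: by end_near. Qed.

Lemma compact_mdist_bounded D (x0 : X) : compact D ->
  exists2 r : R, 0 <= r & forall x, D x -> mdist x0 x <= r.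
Proof.
move=> cD.
have : \forall r \near +oo%R, D `<=` [set x | mdist x0 x <= r].
  apply: (compact_near_coveringP D).1 => // x _.
  exists ([set y | mdist x y < 1], [set r : R | mdist x0 x + 1 <= r]).
    by split => /=; [exact: near_mdist|exact: nbhs_pinfty_ge (num_real _)].
  move=> [y r] /= [xy xr]; have := metric_triangle x0 x y; lra.
move=> H; have : \forall r \near +oo%R, 0 <= r /\ (D `<=` [set x | mdist x0 x <= r]).
  near=> r; split; first by near: r; exact: nbhs_pinfty_ge (num_real _).
  by near: r.
by move=> /filter_ex [r [r0 hr]]; exists r.
Unshelve. all: by end_near. Qed.

(** Only where [f x] is not small does the inequality have content, and there
    [x] ranges over a compact set. *)
Lemma isC0_unif f (e : R) : isC0 f -> (forall x, 0 <= f x) -> 0 < e ->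
  exists2 d : R, 0 < d & forall x y, mdist x y < d -> f x - e <= f y.
Proof.
move=> [cf vf] f0 e0.
have : \forall d \near (0:R)^'+,
    [set x | e <= `|f x|] `<=` [set x | forall y, mdist x y < d -> f x - e <= f y].
  apply: (compact_near_coveringP _).1 => [|x _]; first exact: vf.
  have e2 : 0 < e / 2 by rewrite divr_gt0.
  have /cvgrPdist_lt/(_ _ e2) := cf x.
  move=> /nbhs_ballP[d /= d0 xd]; have d2 : 0 < d / 2 by rewrite divr_gt0.
  exists ([set y | mdist x y < d / 2], [set e | e < d / 2]).
    by split => /=; [exact: near_mdist|exact: nbhs_right_lt].
  move=> [y e'] /= [xy ed] z yz.
  have := xd y; have := xd z; rewrite ballEmdist /= !ltr_norml.
  have dxz : mdist x z < d by have := metric_triangle x y z; lra.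
  have dxy : mdist x y < d by lra.
  by move=> /(_ dxz)/andP[h1 h2] /(_ dxy)/andP[h3 h4]; lra.
move=> H; have : \forall d \near (0:R)^'+, 0 < d /\ ([set x | e <= `|f x|] `<=`
    [set x | forall y, mdist x y < d -> f x - e <= f y]).
  near=> d; split; first by near: d; exact: nbhs_right_gt.
  by near: d.
move=> /filter_ex [d [d0 hd]]; exists d => // x y xy.
have [ef|fe] := leP e `|f x|; first exact: hd xy.
by have := f0 y; rewrite ger0_norm// in fe; lra.
Unshelve. all: by end_near. Qed.

(** The approximation is an inf-convolution of [f], with a slope for which the
    points at distance at least [d] from [x] cost as much as an upper bound [B]
    of [f]: only the points closer than [d] matter, and there [f] is at least
    [f x - e]. Lying between 0 and [f], it vanishes at infinity. *)
Lemma lip_approx_ge0 f (e : R) : isC0 f -> (forall x, 0 <= f x) -> 0 < e ->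
  exists g n, [/\ isC0 g, 0 <= n, lipr n g & forall x, `|f x - g x| <= e].
Proof.
move=> f0 fge0 e0; have [d d0 hd] := isC0_unif f0 fge0 e0.
have [B B0 hB] := isC0_bounded f0.
have n0 : 0 <= B / d by rewrite divr_ge0// ltW.
have lg := lipr_infconv n0 fge0.
have gle := infconv_le_fun n0 fge0; have gge := infconv_ge0 n0 fge0.
exists (infconv (B / d) f), (B / d); split => //.
  apply: isC0_dom (lipr_continuous lg) f0 _ => x.
  by rewrite !ger0_norm.
move=> x; rewrite ger0_norm ?subr_ge0// lerBlDr -lerBlDl.
apply: infconv_lb => y; have [xy|xy] := ltP (mdist x y) d.
  have := hd _ _ xy; have := mdist_ge0 x y; nra.
have : B <= B / d * mdist x y.
  by rewrite mulrAC -mulrA ler_peMr// ler_pdivlMr// mul1r.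
have := hB x; rewrite ger0_norm// => h1 h2; have := fge0 y; lra.
Qed.

Lemma liprD n1 n2 f g : lipr n1 f -> lipr n2 g -> lipr (n1 + n2) (f \+ g).
Proof.
move=> hf hg x y; rewrite /= opprD addrACA mulrDl.
by rewrite (le_trans (ler_normD _ _))// lerD.
Qed.

Lemma liprZ n t f : lipr n f -> lipr (`|t| * n) (t \*o f).
Proof.
by move=> hf x y; rewrite /= -mulrBr normrM -mulrA ler_wpM2l.
Qed.

Lemma isC0_pos f : isC0 f -> isC0 (fun x => Num.max 0 (f x)).
Proof.
move=> f0; apply: (isC0_dom _ f0) => x.
  have := f0.1 x => fx.
  apply: (@continuous_max _ _ (fun=> 0) f x) => //; exact: cst_continuous.
by rewrite (ger0_norm (_ : 0 <= Num.max 0 (f x))) ?le_max ?lexx// ge_max normr_ge0 ler_norm.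
Qed.

Lemma lip_approx f (e : R) : isC0 f -> 0 < e ->
  exists g n, [/\ isC0 g, 0 <= n, lipr n g & forall x, `|f x - g x| <= e].
Proof.
move=> f0 e0; have e2 : 0 < e / 2 by rewrite divr_gt0.
have [|g1 [n1 [g10 n10 l1 d1]]] := lip_approx_ge0 (isC0_pos f0) _ e2.
  by move=> x; rewrite le_max lexx.
have [|g2 [n2 [g20 n20 l2 d2]]] := lip_approx_ge0 (isC0_pos (isC0Z (-1) f0)) _ e2.
  by move=> x; rewrite le_max lexx.
exists (g1 \+ (-1 \*o g2)), (n1 + `|-1| * n2); split.
- by apply: isC0D => //; exact: isC0Z.
- by rewrite addr_ge0// mulr_ge0.
- by apply: liprD => //; exact: liprZ.
move=> x; have := d1 x; have := d2 x; rewrite /= !ler_norml.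
move=> /andP[h1 h2] /andP[h3 h4].
have : f x = Num.max 0 (f x) - Num.max 0 (-1 * f x).
  by rewrite mulN1r /Num.max; case: ltP => h5; case: ltP => h6; lra.
by move=> fE; apply/andP; split; lra.
Qed.

End MetricFunctions.

(** * The Lipschitz triple *)

Lemma nnsup_ge0 (R : realType) (S : set (\bar R)) : (0 <= nnsup S)%E.
Proof. by apply: ereal_sup_ubound; left. Qed.

Lemma nnsup_ub (R : realType) (S : set (\bar R)) x : S x -> (x <= nnsup S)%E.
Proof. by move=> Sx; apply: ereal_sup_ubound; right. Qed.

Lemma nnsup_le (R : realType) (S : set (\bar R)) (x : \bar R) :
  (0 <= x)%E -> (forall y, S y -> (y <= x)%E) -> (nnsup S <= x)%E.
Proof.
by move=> x0 Sx; apply: ge_ereal_sup => y [->//|]; exact: Sx.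
Qed.

Lemma pair_ext (S T : Type) (p q : S * T) : p.1 = q.1 -> p.2 = q.2 -> p = q.
Proof. by case: p; case: q => ? ? ? ? /= -> ->. Qed.

Section LipschitzPair.
Context {R : realType} {X : metricType R}.
Local Notation C := (Cplx R).
Local Notation A := (C0 R X).
Implicit Types (f g : X -> R) (a b : A) (u v : A * C).

Lemma Lip_le a (t : R) : 0 <= t ->
  (Lip a <= t%:E)%E <-> forall x y, rnorm (a x - a y) <= t * mdist x y.
Proof.
move=> t0; split=> [at_ x y|at_].
  have [->|/eqP xy] := eqVneq x y.
    by rewrite subrr rnorm0 mdistxx mulr0.
  have d0 : 0 < mdist x y by rewrite mdist_gt0; apply/eqP.
  rewrite -ler_pdivrMr// -lee_fin; apply: le_trans at_.
  by apply: nnsup_ub; exists (x, y).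
apply: nnsup_le; first by rewrite lee_fin.
move=> _ [[x y] /= xy <-]; rewrite lee_fin ler_pdivrMr//.
by rewrite mdist_gt0; apply/eqP.
Qed.

Lemma Lip_rC0 f (t : R) : isC0 f -> 0 <= t ->
  (Lip (rC0 f) <= t%:E)%E <-> lipr t f.
Proof.
move=> f0 t0; rewrite Lip_le//; split=> ft x y; have := ft x y.
  by rewrite !rC0E// -(rmorphB (real_complex R)) rnorm_real.
by rewrite !rC0E// -(rmorphB (real_complex R)) rnorm_real.
Qed.

Lemma Lip_ge0 a : (0 <= Lip a)%E. Proof. exact: nnsup_ge0. Qed.

Lemma LipD a b : (Lip (a + b)%R <= Lip a + Lip b)%E.
Proof.
apply: nnsup_le; first by rewrite adde_ge0// Lip_ge0.
move=> _ [[x y] /= xy <-].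
have d0 : 0 < mdist x y by rewrite mdist_gt0; apply/eqP.
apply: (@le_trans _ _ ((rnorm (a x - a y) / mdist x y)%:E +
                       (rnorm (b x - b y) / mdist x y)%:E)%E).
  rewrite -EFinD lee_fin -mulrDl ler_pM2r ?invr_gt0//.
  rewrite [X in rnorm X <= _](_ : _ = (a x - a y) + (b x - b y)); first exact: rnormD.
  by change (a x + b x - (a y + b y) = (a x - a y) + (b x - b y)); rewrite opprD addrACA.
by apply: leeD; apply: nnsup_ub; exists (x, y).
Qed.

Lemma Lip_fin a : (Lip a < +oo)%E -> exists2 l : R, 0 <= l & Lip a = l%:E.
Proof.
have := Lip_ge0 a; case: (Lip a) => // l; rewrite lee_fin => l0 _.
by exists l.
Qed.

Lemma LipZ_le (t l : R) a : 0 <= l -> (Lip a <= l%:E)%E ->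
  (Lip (t%:C *: a)%R <= (`|t| * l)%:E)%E.
Proof.
move=> l0 al; apply/Lip_le => [|x y]; first by rewrite mulr_ge0.
have -> : (t%:C *: a : A) x - (t%:C *: a : A) y = t%:C * (a x - a y).
  by rewrite mulrBr.
rewrite rnormM rnorm_real -mulrA ler_wpM2l//.
by move/Lip_le : al; apply.
Qed.

Lemma LipZ (t : R) a : (Lip a < +oo)%E ->
  Lip (t%:C *: a)%R = (`|t|%:E * Lip a)%E.
Proof.
move=> /Lip_fin[l l0 al].
have ub : (Lip (t%:C *: a)%R <= (`|t| * l)%:E)%E by apply: LipZ_le; rewrite ?al.
rewrite al -EFinM; apply/eqP; rewrite eq_le ub/=.
have [->|t0] := eqVneq t 0; first by rewrite normr0 mul0r Lip_ge0.
have [l' l'0 al'] := Lip_fin (le_lt_trans ub (ltry _)).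
have : (Lip (t^-1%:C *: (t%:C *: a))%R <= (`|t^-1| * l')%:E)%E.
  by apply: LipZ_le; rewrite ?al'.
rewrite scalerA -(rmorphM (real_complex R)) mulVf// scale1r al lee_fin => ll'.
rewrite al' lee_fin mulrC -ler_pdivlMr ?normr_gt0//.
by rewrite mulrC -normfV.
Qed.

Lemma usa_real u : usa u -> u.2 = (complex.Re u.2)%:C /\
  u.1 = rC0 (fun x => complex.Re (u.1 x)).
Proof.
move=> [_ /c0_selfadjP u1 u2]; split => //.
case: (u.2) u2 => p q /= [] hq; congr Complex; lra.
Qed.

Hypothesis lc : locally_compact [set: X].

Lemma exists_bump (x : X) : exists2 k : X -> R, isC0 k & k x = 1.
Proof.
have [k [D [n [cD n0 kn /all_and3[k01 kK kD]]]]] := bump lc (@compact_set1 X x).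
by exists k; [exact: isC0_support (lipr_continuous kn) cD kD|exact: kK].
Qed.

Lemma is_unit_val (e : A) x : is_unit e -> e x = 1.
Proof.
move=> eu; have [k k0 kx] := exists_bump x.
have : (e ** rC0 k) x = rC0 k x by rewrite (eu _).1.
change (e x * rC0 k x = rC0 k x -> e x = 1).
by rewrite rC0E// kx mulr1.
Qed.

Lemma isC0_cst (c : R) : compact [set: X] -> isC0 (fun _ : X => c).
Proof.
move=> cX; apply: (@isC0_support _ _ _ setT) => //; last by move=> x /(_ I).
exact: cst_continuous.
Qed.

Lemma compact_unital : compact [set: X] -> unital A.
Proof.
move=> cX; have c0 := isC0_cst 1 cX; exists (rC0 (fun=> 1)) => a.
split; apply: c0_eqP => x.
  by change (rC0 (fun=> 1) x * a x = a x); rewrite rC0E// mul1r.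
by change (a x * rC0 (fun=> 1) x = a x); rewrite rC0E// mulr1.
Qed.

Lemma unital_compact : unital A -> compact [set: X].
Proof.
move=> [e eu]; have [_ /(_ 1 ltr01)] := c0P e.
rewrite [X in compact X](_ : _ = setT)//; apply/seteqP; split => // x _ /=.
by rewrite is_unit_val// (rnorm_real 1) normr1.
Qed.

Lemma isC0_gt_compact f (c : R) : isC0 f -> 0 < c -> (forall x, c <= `|f x|) ->
  compact [set: X].
Proof.
move=> f0 c0 fc; have := f0.2 _ c0; rewrite [X in compact X](_ : _ = setT)//.
by apply/seteqP; split => // x _ /=.
Qed.

(** The constants are the only functions of Lipschitz constant 0. The nonzero
    ones belong to [C0(X)] exactly when [X] is compact, that is, when the algebra is
    unital, which is why both descriptions of the unit give the same kernel. *)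
Lemma Lip_lipschitz_pair : lipschitz_pair (unit_ext (@Lip R X)).
Proof.
split.
- split; rewrite /unit_ext.
  + by move=> u _; exact: Lip_ge0.
  + by move=> u v _ _; exact: LipD.
  + by move=> t u [_ uoo]; exact: LipZ.
- move=> u e us e0; have [u2 u1] := usa_real us.
  have e2 : 0 < e / 2 by rewrite divr_gt0.
  pose f x := complex.Re (u.1 x); have f0 : isC0 f by exact: isC0_Re.
  have [g [n [g0 n0 gn fg]]] := lip_approx f0 e2.
  exists (rC0 g, u.2).
    split; last first.
      have /(Lip_rC0 g0 n0) := gn; move/le_lt_trans; apply; exact: ltry.
    by case: us => uu _ u2s; split => //=; exact: rC0_selfadj.
  apply: (@le_lt_trans _ _ (e / 2)); last by lra.
  apply: ge_sup.
    by exists (rnorm (umul (u - (rC0 g, u.2)) 0)), 0 => //=; rewrite normr0.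
  move=> _ [b b1 <-]; rewrite /umul /= subrr scale0r addr0.
  apply: supnorm_le => [|x]; first exact: ltW.
  change (rnorm ((u.1 x - rC0 g x) * b x) <= e / 2).
  rewrite rnormM u1 rC0E// rC0E// -(rmorphB (real_complex R)) rnorm_real.
  rewrite -[leRHS]mulr1; apply: ler_pM; rewrite ?rnorm_ge0 ?normr_ge0 ?fg//.
  by apply: le_trans (supnorm_ge b x) _; rewrite -lecR.
- apply/seteqP; split => [u [us Lu]|_ [t _ <-]].
  + have [u2 u1] := usa_real us.
    pose f x := complex.Re (u.1 x); have f0 : isC0 f by exact: isC0_Re.
    have fxy x y : f x = f y.
      have /(Lip_rC0 f0 (lexx 0))/(_ x y) : (Lip (rC0 f) <= 0%:E)%E.
        by rewrite /f -u1; move: Lu; rewrite /unit_ext => ->.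
      by rewrite mul0r normr_le0 subr_eq0 => /eqP.
    rewrite /uone; case: asboolP => [un|nun].
      have eu : is_unit (xget 0 (@is_unit R A)) by case: un => e; exact: xgetI.
      have u20 : u.2 = 0 by case: us => /(_ un).
      (* An empty [X] has no value [f x0] to serve as the scalar. *)
      have [x0|nx] := pselect (exists x : X, True); last first.
        exists 0 => //; apply: pair_ext => /=; last by rewrite u20 scaler0.
        by apply: c0_eqP => x; case: nx; exists x.
      case: x0 => x0 _; exists (f x0) => //.
      apply: pair_ext => /=; last by rewrite u20 scaler0.
      apply: c0_eqP => x; change ((f x0)%:C * xget 0 (@is_unit R A) x = u.1 x).
      by rewrite is_unit_val// mulr1 u1 rC0E// (fxy x0 x).
    exists (complex.Re u.2) => //.
    apply: pair_ext => /=.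
      rewrite scaler0 u1; apply: c0_eqP => x; rewrite rC0E//.
      have [->//|fx] := eqVneq (complex.Re (u.1 x)) 0; case: nun; apply: compact_unital.
      apply: (@isC0_gt_compact f `|f x|) => //; first by rewrite normr_gt0.
      by move=> y; rewrite (fxy x y).
    by rewrite u2; change ((complex.Re u.2)%:C * 1 = (complex.Re u.2)%:C); rewrite mulr1.
  + rewrite /uone; case: asboolP => [un|nun]; last first.
      split; last first.
        rewrite /unit_ext /= scaler0; apply/eqP; rewrite eq_le Lip_ge0 andbT.
        by apply/Lip_le => // x y; rewrite subrr rnorm0 mul0r.
      split => //=; first by rewrite scaler0; apply: c0_eqP => x; exact: conjc0.
      change ((t%:C * 1)^* = t%:C * 1 :> R[i]); rewrite mulr1; exact: conjc_real.
    have eu : is_unit (xget 0 (@is_unit R A)) by case: un => e; exact: xgetI.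
    split; last first.
      rewrite /unit_ext /=; apply/eqP; rewrite eq_le Lip_ge0 andbT.
      apply/Lip_le => // x y; rewrite mul0r.
      change (rnorm (t%:C * xget 0 (@is_unit R A) x - t%:C * xget 0 (@is_unit R A) y : C) <= 0).
      by rewrite !is_unit_val// subrr rnorm0.
    split => /=; [by move=> _; exact: mulr0| |]; last first.
      change ((t%:C * 0)^* = t%:C * 0 :> R[i]); rewrite mulr0; exact: conjc0.
    apply: c0_eqP => x; change ((t%:C * xget 0 (@is_unit R A) x)^* = t%:C * xget 0 (@is_unit R A) x).
    by rewrite is_unit_val// mulr1; exact: conjc_real.
Qed.

(** The approximate identity is indexed by all the positive elements of the
    unit ball, in their own order; this is directed by pointwise maxima, and
    beyond a bump over [{ |a| >= d / 2 }] all of them fix [a] up to [d / 2]. *)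
Lemma C0_topographic : topographic [set: A].
Proof.
split.
  split => //.
  by move=> a b _ _; apply: c0_eqP => x; exact: mulrC.
pose I := {a : A | positive a /\ `|a| <= 1}.
have val_le1 (i : I) x : exists2 s : R, 0 <= s <= 1 & sval i x = s%:C.
  case: i => a [/c0_positiveP/(_ x) ax a1] /=.
  exists (complex.Re (a x)); last by rewrite RRe_real// ger0_real.
  rewrite -lecR RRe_real ?ger0_real// ax/=.
  apply: le_trans (ler_norm _) _; apply: le_trans (Re_le_rnorm _) _.
  by apply: le_trans (supnorm_ge a x) _; rewrite -lecR.
have mkI f : isC0 f -> (forall x, 0 <= f x <= 1) -> positive (rC0 f) /\ `|rC0 f| <= 1.
  move=> f0 f01; split; first by apply/c0_positiveP => x; rewrite rC0E// lecR; case/andP: (f01 x).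
  rewrite c0_normE lecR; apply: supnorm_rC0_le => // x.
  by have /andP[f1 f2] := f01 x; rewrite ger0_norm.
have posB a b x : positive (b - a) -> 0 <= (b x - a x : R[i]).
  by move=> /c0_positiveP/(_ x).
exists I, (fun i j => positive (sval j - sval i)), (fun i => sval i); split.
- split.
  + have c0 : isC0 (fun _ : X => 0 : R).
      apply: (@isC0_support _ _ _ set0) => //; [exact: cst_continuous|exact: compact0].
    by apply: inhabits; exists (rC0 (fun=> 0)); apply: mkI => // x; rewrite lexx ler01.
  + by move=> i; apply/c0_positiveP => x; change (0 <= sval i x - sval i x :> R[i]); rewrite subrr.
  + move=> i j k ij jk; apply/c0_positiveP => x.
    have := addr_ge0 (posB _ _ x jk) (posB _ _ x ij).
    by rewrite addrA subrK.
  + move=> i j.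
    pose p x := complex.Re (sval i x); pose q x := complex.Re (sval j x).
    pose f x := Num.max (p x) (q x).
    have pE x : sval i x = (p x)%:C by have [s _ h] := val_le1 i x; rewrite /p h.
    have qE x : sval j x = (q x)%:C by have [s _ h] := val_le1 j x; rewrite /q h.
    have p01 x : 0 <= p x <= 1 by have [s + h] := val_le1 i x; rewrite /p h.
    have q01 x : 0 <= q x <= 1 by have [s + h] := val_le1 j x; rewrite /q h.
    have p0 : isC0 p by exact: isC0_Re.
    have q0 : isC0 q by exact: isC0_Re.
    have f0 : isC0 f.
      apply: (isC0_dom _ (isC0D p0 q0)) => x.
        by apply: continuous_max; [exact: p0.1|exact: q0.1].
      have /andP[p1 _] := p01 x; have /andP[q1 _] := q01 x.
      by rewrite /f /Num.max /=; case: ifP => _; rewrite !ger0_norm; lra.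
    have f01 x : 0 <= f x <= 1.
      by rewrite /f /Num.max; case: ifP.
    exists (exist _ (rC0 f) (mkI _ f0 f01)); apply/c0_positiveP => x /=.
      change (0 <= rC0 f x - sval i x :> R[i]).
      by rewrite rC0E// pE -(rmorphB (real_complex R)) ler0c subr_ge0 /f le_max lexx.
    change (0 <= rC0 f x - sval j x :> R[i]).
    by rewrite rC0E// qE -(rmorphB (real_complex R)) ler0c subr_ge0 /f le_max lexx orbT.
- by move=> [a [pa a1]].
- by move=> i j.
- move=> a d d0; have d2 : 0 < d / 2 by rewrite divr_gt0.
  have [_ /(_ _ d2) ca] := c0P a.
  have [k [D [n [cD n0 kn /all_and3[k01 kK kD]]]]] := bump lc ca.
  have k0 : isC0 k by exact: isC0_support (lipr_continuous kn) cD kD.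
  exists (exist _ (rC0 k) (mkI _ k0 k01)) => j /= kj.
  have comm : a ** sval j = sval j ** a by apply: c0_eqP => x; exact: mulrC.
  rewrite comm; suff : rnorm (sval j ** a - a) < d by [].
  apply: (@le_lt_trans _ _ (d / 2)); last by lra.
  apply: supnorm_le => [|x]; first exact: ltW.
  change (rnorm (sval j x * a x - a x : C) <= d / 2).
  have [s /andP[s0 s1] sE] := val_le1 j x.
  have -> : sval j x * a x - a x = (s - 1)%:C * a x.
    by rewrite sE rmorphB mulrBl mul1r.
  rewrite rnormM rnorm_real ler0_norm ?subr_le0// opprB.
  have [/kK kx|/ltW ax] := leP (d / 2) (rnorm (a x)).
    have := posB _ _ x kj; rewrite rC0E// kx sE -(rmorphB (real_complex R)) ler0c => s1'.
    have -> : 1 - s = 0 by lra.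
    by rewrite mul0r ltW.
  have := rnorm_ge0 (a x); nra.
Qed.

End LipschitzPair.

(** * Characters are evaluations *)

Section Characters.
Context {R : realType} {X : topologicalType}.
Local Notation C := (Cplx R).
Local Notation A := (C0 R X).
Implicit Types (f g k q : X -> R) (a b : A).

Section Character.
Context (x : A -> C).
Hypothesis xL : forall (c : R[i]) a b, x (c *: a + b) = c * x a + x b.
Hypothesis xM : forall a b, x (a ** b) = x a * x b.

Let x0 : x 0 = 0.
Proof. by have := xL (-1) 0 0; rewrite scaler0 addr0 mulN1r addNr. Qed.

Let xZ c a : x (c *: a) = c * x a.
Proof. by rewrite -[c *: a]addr0 xL x0 addr0. Qed.

Let xD a b : x (a + b) = x a + x b.
Proof. by rewrite -[a]scale1r xL mul1r scale1r. Qed.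

(** Otherwise [a / (l - a)], with [l] the value of the character at [a], would
    be an element [c] of the algebra with [l c = a + a c], whence [l = 0]. *)
Lemma character_range a : x a != 0 -> exists p, a p = x a.
Proof.
move=> l0; apply: contrapT => /forallNP anl.
set l := x a in l0 anl.
have la p : l - a p != 0 by rewrite subr_eq0; apply/eqP => /esym; exact: anl.
have [ca va] := c0P a.
pose c : X -> C := fun p => a p * (l - a p)^-1.
have cc : continuous c.
  move=> p; apply: (@cvgM _ _ (nbhs p)); first exact: ca.
  apply: (@cvgV _ _ (nbhs p)); first exact: la.
  by apply: (@cvgB _ C _ (nbhs p)); [exact: cvg_cst|exact: ca].
have nl : 0 < rnorm (l : C).
  by rewrite lt_neqAle rnorm_ge0 andbT eq_sym; apply: contra l0 => /eqP/rnorm_eq0 ->.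
have cv : vanishes_at_infinity c.
  apply: c0_dom => // e e0.
  exists [set p | e * rnorm (l : C) / (1 + e) <= rnorm (a p)].
    by apply: va; rewrite divr_gt0// ?mulr_gt0// ltr_pwDl// ltW.
  move=> p /=; rewrite ler_pdivrMr; last by lra.
  have lap : 0 < rnorm (l - a p : C).
    by rewrite lt_neqAle rnorm_ge0 andbT eq_sym; apply: contra (la p) => /eqP/rnorm_eq0 ->.
  have -> : rnorm (c p) = rnorm (a p) / rnorm (l - a p : C).
    have lap0 : rnorm (l - a p : C) != 0 by rewrite gt_eqF.
    apply: (mulIf lap0); rewrite -[RHS]mulrA mulVf// mulr1 -rnormM /c.
    by rewrite -mulrA mulVf// mulr1.
  rewrite ler_pdivlMr// => h.
  have : rnorm (l : C) <= rnorm (l - a p : C) + rnorm (a p).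
    by have := rnormD (l - a p : C) (a p); rewrite subrK.
  have := rnorm_ge0 (a p); nra.
have cP : c \in c0_pred by rewrite inE.
have : l *: MkC0 cP = a + a ** MkC0 cP.
  apply: c0_eqP => p; change (l * c p = a p + a p * c p).
  have fieldE (s t : R[i]) : t - s != 0 ->
      t * (s * (t - s)^-1) = s + s * (s * (t - s)^-1).
    by move=> ts; field.
  exact: fieldE (la p).
move=> /(congr1 x); rewrite xZ xD xM -/l => /eqP.
by rewrite -subr_eq0 opprD addrCA subrr addr0 oppr_eq0 (negbTE l0).
Qed.

Lemma character_real f : isC0 f -> x (rC0 f) = (complex.Re (x (rC0 f)))%:C.
Proof.
move=> f0; have [->//|/character_range[p <-]] := eqVneq (x (rC0 f)) 0.
by rewrite rC0E.
Qed.

Hypothesis x_neq0 : exists a, x a != 0.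

Let peak : exists k, isC0 k /\ exists2 c : R, 0 < c & x (rC0 k) = c%:C.
Proof.
have [f f0 xf] : exists2 f, isC0 f & x (rC0 f) != 0.
  case: x_neq0 => a; rewrite (c0_ReIm a) xD xZ => xa.
  have [re0|] := eqVneq (x (rC0 (fun p => complex.Re (a p)))) 0; last first.
    by move=> re; exists (fun p => complex.Re (a p)) => //; exact: isC0_Re.
  exists (fun p => complex.Im (a p)); first exact: isC0_Im.
  by apply: contra xa => /eqP ->; rewrite re0 mulr0 addr0.
have xfE := character_real f0; exists (f \* f); split; first exact: isC0M.
exists (complex.Re (x (rC0 f)) ^+ 2).
  rewrite lt_neqAle sqr_ge0 andbT eq_sym sqrf_eq0.
  by apply: contra xf; rewrite xfE => /eqP ->.
by rewrite rC0M// xM {1 2}xfE expr2; exact/esym/(rmorphM (real_complex R)).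
Qed.

(** If [k] and [q] are real-valued with [x k = c > 0] and [x q = 0], then
    [k + i q] takes the value [c] somewhere by [character_range], and there
    [k = c] and [q = 0]. So the zero sets in the compact set [{ |k| >= c }] of
    the nonnegative [q] in the kernel of [x] are nonempty, and they are directed
    because the zero set of a sum is an intersection: they have a common point
    [p]. The character is the evaluation at [p], because for real [f] the
    square of [k (f - x f)] is such a [q]. *)
Lemma character_eval : exists p, forall a, x a = a p.
Proof.
have [k [k0 [c c0 xk]]] := peak.
pose Q q := [/\ isC0 q, (forall p, 0 <= q p) & x (rC0 q) = 0].
pose K := [set p | c <= `|k p|].
pose F := filter_from Q (fun q => [set p | K p /\ q p = 0]).
have FF : ProperFilter F.
  apply: filter_from_proper.
    apply: filter_from_filter.
      exists (0 \*o k); split; first exact: isC0Z.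
      + by move=> p /=; rewrite mul0r.
      + by rewrite rC0Z// xZ mul0r.
    move=> q1 q2 [q10 q1ge xq1] [q20 q2ge xq2]; exists (q1 \+ q2).
      split; first exact: isC0D.
      + by move=> p /=; rewrite addr_ge0.
      + by rewrite rC0D// xD xq1 xq2 addr0.
    move=> p [Kp /eqP]; rewrite /= paddr_eq0// => /andP[/eqP ? /eqP ?].
    by split.
  move=> q [q0 qge xq].
  have xkq : x (rC0 k + 'i%C *: rC0 q) = c%:C by rewrite xD xZ xq mulr0 addr0.
  have [|p] := @character_range (rC0 k + 'i%C *: rC0 q).
    by rewrite xkq; apply/eqP => /complexI ce; rewrite ce ltxx in c0.
  rewrite xkq; change (rC0 k p + 'i%C * rC0 q p = c%:C -> [set p0 | K p0 /\ q p0 = 0] !=set0).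
  rewrite !rC0E// => -[h1 h2]; exists p; split; last by lra.
  by rewrite /K /= (_ : k p = c) ?gtr0_norm//; lra.
have [p [Kp clp]] : K `&` cluster F !=set0.
  apply: k0.2 => //; exists (0 \*o k); last by move=> p [].
  split; first exact: isC0Z.
  - by move=> p /=; rewrite mul0r.
  - by rewrite rC0Z// xZ mul0r.
have kp : k p != 0.
  by apply/eqP => kp; move: Kp; rewrite /K /= kp normr0 leNgt c0.
have Qp q : Q q -> q p = 0.
  move=> Qq; have cq : closed [set p | q p = 0].
    apply: (@preimage_closed _ _ q [set y | y = 0]); last exact: closed_eq.
    by move=> y _; case: Qq => -[cq _] _ _; exact: cq.
  move: clp; rewrite clusterE => /(_ [set p | q p = 0]).
  rewrite -((closure_id _).1 cq); apply; exists q => //.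
  by move=> y [].
have real f : isC0 f -> x (rC0 f) = (f p)%:C.
  move=> f0; have xf := character_real f0; set t := complex.Re _ in xf.
  pose h := (k \* f) \+ (- t \*o k).
  have h0 : isC0 h by apply: isC0D; [exact: isC0M|exact: isC0Z].
  have xh : x (rC0 h) = 0.
    rewrite (rC0D (isC0M k0 f0) (isC0Z _ k0)) (rC0M k0 f0) (rC0Z _ k0).
    by rewrite xD xM xZ xf xk mulrC (rmorphN (real_complex R)) mulNr subrr.
  have : (h \* h) p = 0.
    apply: Qp; split; first exact: isC0M.
      by move=> y /=; rewrite -expr2 sqr_ge0.
    by rewrite rC0M// xM xh mul0r.
  rewrite /= -expr2 => /eqP; rewrite sqrf_eq0 /h /= mulrC mulNr -mulrBl mulf_eq0.
  by rewrite (negbTE kp) orbF subr_eq0 => /eqP fp; rewrite xf fp.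
exists p => a; rewrite {1}(c0_ReIm a) xD xZ real; last exact: isC0_Re.
by rewrite real; [exact/esym/complexE|exact: isC0_Im].
Qed.

End Character.

End Characters.

(** * The spectrum and the indicator functions of its compact subsets *)

Section PointwiseTopology.
Context {T : topologicalType} {R : realType}.

Lemma near_ptws_cplx (phi : {ptws T -> Cplx R}) (t : T) (e : R) : 0 < e ->
  \forall psi \near phi, rnorm (phi t - psi t : Cplx R) < e.
Proof.
move=> e0; have FF : Filter (nbhs phi) := @nbhs_filter _ phi.
have := (@pointwise_cvgP _ (Cplx R) (nbhs phi) phi FF).1 (@cvg_id _ (nbhs phi)) t.
by move=> /(@cvg_rnormP R (Cplx R) _ _ FF)/(_ e e0).
Qed.

Lemma near_ptws_real (w : {ptws T -> R}) (t : T) (e : R) : 0 < e ->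
  \forall w' \near w, `|w t - w' t| < e.
Proof.
move=> e0; have FF : Filter (nbhs w) := @nbhs_filter _ w.
have := (@pointwise_cvgP _ R (nbhs w) w FF).1 (@cvg_id _ (nbhs w)) t.
by move=> /cvgrPdist_lt/(_ e e0).
Qed.

End PointwiseTopology.

Section Spectrum.
Context {R : realType} {X : metricType R}.
Hypothesis lc : locally_compact [set: X].
Local Notation C := (Cplx R).
Local Notation A := (C0 R X).
Local Notation M := [set: A].
Implicit Types (f g k q : X -> R) (a b : A) (K : set {ptws M -> C}).

Definition inM a : M := SigSub (in_setT a).

Lemma inMK (f : M) : inM (val f) = f. Proof. exact: val_inj. Qed.

Definition ev (p : X) : {ptws M -> C} := fun f : M => val f p.

Lemma spectrum_ev p : spectrum (M := M) (ev p).
Proof.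
split.
- have [k k0 kp] := exists_bump lc p; exists (inM (rC0 k)).
  by rewrite /ev /= rC0E// kp; exact: oner_neq0.
- by move=> c f g h hE; rewrite /ev hE.
- by move=> f g h hE; rewrite /ev hE.
Qed.

Lemma spectrumP (x : {ptws M -> C}) : spectrum (M := M) x -> exists p, x = ev p.
Proof.
move=> [[f xf] xL xM].
have [|||p xp] := @character_eval R X (fun a => x (inM a)).
- by move=> c a b; apply: xL.
- by move=> a b; apply: xM.
- by exists (val f); rewrite inMK.
by exists p; apply/funext => g; rewrite -(inMK g) xp.
Qed.

(** A bump at [p0] is nonzero at the characters near the evaluation at [p0], so
    these are evaluations at points of its support. *)
Lemma compact_spectrum K : compacts K ->
  exists2 D, compact D & forall x, K x -> exists2 p, D p & x = ev p.
Proof.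
move=> [cK Ks].
pose F := @compact_dir X.
have : \near F, K `<=` [set x | exists2 p, F p & x = ev p].
  apply: (near_covering_withinP K).2 => //; first exact/compact_near_coveringP.
  move=> x0 /Ks/spectrumP[p0 ->].
  have [k [D [n [cD n0 kn /all_and3[k01 kK kD]]]]] := bump lc (@compact_set1 X p0).
  have k0 : isC0 k by exact: isC0_support (lipr_continuous kn) cD kD.
  exists ([set x | rnorm (ev p0 (inM (rC0 k)) - x (inM (rC0 k)) : C) < 1],
          [set D2 | compact D2 /\ D `<=` D2]).
    by split; [exact: near_ptws_cplx|exists D].
  move=> [x D2] /= [+ [c2 DD2]] /Ks/spectrumP[p xp].
  rewrite xp /ev /= !rC0E// -(rmorphB (real_complex R)) rnorm_real kK// => kp.
  exists p => //; apply: DD2; apply: contrapT => /kD kp0.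
  by rewrite kp0 subr0 normr1 ltxx in kp.
move=> [D cD hD]; exists D => // x.
exact: (hD D (conj cD (@subset_refl _ D))).
Qed.

Lemma ev_continuous : continuous ev.
Proof.
move=> p; apply/(@pointwise_cvgP _ C (ev @ p) (ev p)) => t.
exact: (c0P (val t)).1.
Qed.

Lemma compacts_ev (D : set X) : compact D -> compacts (ev @` D).
Proof.
move=> cD; split; last by move=> _ [p _ <-]; exact: spectrum_ev.
apply: continuous_compact => //; apply: continuous_subspaceT; exact: ev_continuous.
Qed.

(** [majorants K], read through the Gel'fand isomorphism. *)
Definition real_majorant K k := [/\ isC0 k, forall p, 0 <= k p & forall p, K (ev p) -> 1 <= k p].

Lemma majorants_rC0 K k : real_majorant K k -> majorants K (inM (rC0 k)).
Proof.
move=> [k0 kge k1] x /spectrumP[p ->]; rewrite /ev /= rC0E//.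
by split=> [|/k1]; [rewrite ler0c|rewrite -lecR].
Qed.

Lemma majorantsP K (f : M) : majorants K f ->
  exists2 k, real_majorant K k & f = inM (rC0 k).
Proof.
move=> Kf; have fge p := (Kf _ (spectrum_ev p)).1.
pose k p := complex.Re (val f p); have fE p : val f p = (k p)%:C.
  by rewrite RRe_real// ger0_real//; exact: fge.
exists k; last by apply: val_inj; exact: rC0_of.
split; first exact: isC0_Re.
  by move=> p; rewrite -ler0c -fE; exact: fge.
by move=> p Kp; rewrite -lecR -fE; exact: (Kf _ (spectrum_ev p)).2.
Qed.

Lemma exists_real_majorant K : compacts K -> exists k D, [/\ real_majorant K k, isC0 k,
  compact D & forall p, 0 <= k p <= 1 /\ (~ D p -> k p = 0)].
Proof.
move=> /compact_spectrum[D cD KD].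
have [k [D' [n [cD' n0 kn /all_and3[k01 kK kD]]]]] := bump lc cD.
have k0 : isC0 k by exact: isC0_support (lipr_continuous kn) cD' kD.
exists k, D'; split => //; last by move=> p; split; [exact: k01|exact: kD].
split => //; first by move=> p; case/andP: (k01 p).
move=> p /KD[q Dq pq]; have : val (inM (rC0 k)) p = val (inM (rC0 k)) q.
  exact: (congr1 (fun x => x (inM (rC0 k))) pq).
by rewrite /= !rC0E// (kK q)// => -[->].
Qed.

Lemma real_majorant_min K k1 k2 : real_majorant K k1 -> real_majorant K k2 ->
  real_majorant K (fun p => Num.min (k1 p) (k2 p)).
Proof.
move=> [k10 ge1 K1] [k20 ge2 K2]; split.
- apply: (isC0_dom _ k10) => p.
    by apply: continuous_min; [exact: k10.1|exact: k20.1].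
  by rewrite !ger0_norm ?ge1 ?le_min ?ge1 ?ge2// ge_min lexx.
- by move=> p; rewrite le_min ge1 ge2.
- by move=> p Kp; rewrite le_min K1// K2.
Qed.

Lemma majorants_dir_filter K : compacts K -> ProperFilter (majorants_dir K).
Proof.
move=> cK; apply: filter_from_proper; last first.
  by move=> f Kf; exists f; split.
apply: filter_from_filter.
  have [k [D [Kk _ _ _]]] := exists_real_majorant cK.
  by exists (inM (rC0 k)); exact: majorants_rC0.
move=> _ _ /majorantsP[k1 K1 ->] /majorantsP[k2 K2 ->].
have K12 := real_majorant_min K1 K2; have [k120 _ _] := K12.
have [k10 _ _] := K1; have [k20 _ _] := K2.
exists (inM (rC0 (fun p => Num.min (k1 p) (k2 p)))); first exact: majorants_rC0.
move=> f [Kf fle]; split; split => // x sx; apply: (le_trans (fle x sx));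
  by move/spectrumP : sx => [p ->]; rewrite /ev /= !rC0E// lecR ge_min lexx ?orbT ?orTb.
Qed.

(** On functionals that are monotone along the majorants, the limit that
    defines the indicator function is an infimum. Monotonicity is asked along
    the majorants, rather than positivity of a linear functional, because this
    is what the outer functional of a compression has. *)
Lemma indicator_mono K (psi : M -> C) (F : (X -> R) -> R) : compacts K ->
  (forall k, real_majorant K k -> psi (inM (rC0 k)) = (F k)%:C) ->
  (forall k, real_majorant K k -> 0 <= F k) ->
  (forall k k', real_majorant K k -> real_majorant K k' -> (forall p, k p <= k' p) -> F k <= F k') ->
  exists I : R, [/\ indicator K psi = I%:C, forall k, real_majorant K k -> I <= F k &
    forall c, (forall k, real_majorant K k -> c <= F k) -> c <= I].
Proof.
move=> cK psiF F0 Fle; have PF := majorants_dir_filter cK.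
pose S := [set F k | k in real_majorant K].
have [k0 [D [Kk0 _ _ _]]] := exists_real_majorant cK.
have lbS : has_inf S.
  by split; [exists (F k0), k0|exists 0 => _ [k Kk <-]; exact: F0].
exists (inf S); split.
- apply: cvg_lim; first exact: norm_hausdorff.
  apply/cvg_rnormP => e e0.
  have [_ [k Kk <-] ke] := inf_adherent e0 lbS.
  exists (inM (rC0 k)); first exact: majorants_rC0.
  move=> f [/majorantsP[k' Kk' ->] fle].
  have k'k p : k' p <= k p.
    have [k'0 _ _] := Kk'; have [kk0 _ _] := Kk.
    by have := fle _ (spectrum_ev p); rewrite /ev /= !rC0E// lecR.
  rewrite psiF// -(rmorphB (real_complex R)) rnorm_real distrC ger0_norm ?subr_ge0.
    by have := Fle _ _ Kk' Kk k'k; lra.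
  by apply: ge_inf; [exact: lbS.2|exists k'].
- by move=> k Kk; apply: ge_inf; [exact: lbS.2|exists k].
- move=> c hc; apply: lb_le_inf; first exact: lbS.1.
  by move=> _ [k Kk <-]; exact: hc.
Qed.

End Spectrum.

(** * States as positive functionals on C0 + R *)

Section States.
Context {R : realType} {X : metricType R}.
Hypothesis lc : locally_compact [set: X].
Local Notation C := (Cplx R).
Local Notation A := (C0 R X).
Implicit Types (f g k q w : X -> R) (a b : A) (u v : A * C).

(** The functions of [C0 + R]. The constant [l] is unique unless [X] is compact;
    then every [l] is suitable. *)
Definition isuC0 w := exists l, isC0 (fun x => w x - l).

Definition represents u w := usa u /\ forall x, u.1 x + u.2 = (w x)%:C.

Lemma representsE u w : represents u w -> exists l, [/\ isC0 (fun x => w x - l),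
  u.1 = rC0 (fun x => w x - l) & u.2 = l%:C].
Proof.
move=> [us uw]; have [u2 u1] := usa_real us; exists (complex.Re u.2).
have wE : (fun x => w x - complex.Re u.2) = (fun x => complex.Re (u.1 x)).
  apply/funext => x; have := uw x; rewrite u2.
  by case: (u.1 x) => p q /= -[<- _]; rewrite addrK.
by rewrite wE; split => //; exact: isC0_Re.
Qed.

Lemma represents_rC0 f : isC0 f -> represents (rC0 f, 0) f.
Proof.
move=> f0; split => [|x /=]; last by rewrite addr0 rC0E.
by split => //=; [exact: rC0_selfadj|exact: conjc0].
Qed.

Lemma isC0_isuC0 f : isC0 f -> isuC0 f.
Proof.
by move=> f0; exists 0; rewrite (_ : (fun x => _) = f)//; apply/funext => x; rewrite subr0.
Qed.

Lemma isuC0_cst (c : R) : isuC0 (fun=> c).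
Proof.
exists c; apply: (@isC0_support _ _ _ set0); last by move=> x _; rewrite subrr.
  by move=> x; exact: cvg_cst.
exact: compact0.
Qed.

Lemma isuC0D w1 w2 : isuC0 w1 -> isuC0 w2 -> isuC0 (w1 \+ w2).
Proof.
move=> [l1 h1] [l2 h2]; exists (l1 + l2).
rewrite (_ : (fun x => _) = (fun x => w1 x - l1) \+ (fun x => w2 x - l2)).
  exact: isC0D.
by apply/funext => x /=; rewrite opprD addrACA.
Qed.

Lemma isuC0Z t w : isuC0 w -> isuC0 (t \*o w).
Proof.
move=> [l h]; exists (t * l).
rewrite (_ : (fun x => _) = t \*o (fun x => w x - l)); first exact: isC0Z.
by apply/funext => x /=; rewrite mulrBr.
Qed.

Lemma isuC0B w1 w2 : isuC0 w1 -> isuC0 w2 -> isuC0 (fun x => w1 x - w2 x).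
Proof.
move=> c1 c2; have := isuC0D c1 (isuC0Z (-1) c2).
rewrite (_ : _ \+ _ = fun x => w1 x - w2 x)//.
by apply/funext => x /=; rewrite mulN1r.
Qed.

Lemma isuC0M w k : isuC0 w -> isC0 k -> isC0 (w \* k).
Proof.
move=> [l h] k0.
rewrite (_ : _ \* _ = ((fun x => w x - l) \* k) \+ (l \*o k)).
  by apply: isC0D; [exact: isC0M|exact: isC0Z].
by apply/funext => x /=; rewrite -mulrDl subrK.
Qed.

Lemma isuC0_comp (th : R -> R) w : (forall s t, `|th s - th t| <= `|s - t|) ->
  isuC0 w -> isuC0 (th \o w).
Proof.
move=> hth [l h]; exists (th l); apply: (isC0_dom _ h) => x; last exact: hth.
apply/cvgrPdist_lt => e e0; have /cvgrPdist_lt/(_ _ e0) := h.1 x.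
apply: filterS => y /=; apply: le_lt_trans.
rewrite !opprB; rewrite addrA subrK addrA subrK.
exact: hth.
Qed.

Lemma isuC0_bounded w : isuC0 w -> exists2 B : R, 0 <= B & forall x, `|w x| <= B.
Proof.
move=> [l /isC0_bounded[B B0 hB]]; exists (B + `|l|); first by rewrite addr_ge0.
move=> x; rewrite -[w x](subrK l) (le_trans (ler_normD _ _))// lerD//.
Qed.

Lemma represents_exists w : isuC0 w -> exists u, represents u w.
Proof.
move=> [l wl]; have [un|nun] := pselect (unital A).
  have w0 : isC0 w.
    have := isC0D wl (isC0_cst l (unital_compact lc un)).
    rewrite (_ : _ \+ _ = w)//; apply/funext => x /=; exact: subrK.
  by exists (rC0 w, 0); exact: represents_rC0.
exists (rC0 (fun x => w x - l), l%:C); split => [|x /=].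
  by split => //=; [exact: rC0_selfadj|exact: conjc_real].
by rewrite rC0E// -(rmorphD (real_complex R)) subrK.
Qed.

Lemma representsB u1 u2 w1 w2 : represents u1 w1 -> represents u2 w2 ->
  represents (u1 - u2) (fun x => w1 x - w2 x).
Proof.
move=> [us1 h1] [us2 h2]; split => [|x]; last first.
  change (u1.1 x - u2.1 x + (u1.2 - u2.2) = (w1 x - w2 x)%:C).
  have gen (a b c d : R[i]) (s t : R) : a + c = s%:C -> b + d = t%:C ->
      a - b + (c - d) = (s - t)%:C.
    by move=> e1 e2; rewrite rmorphB /= -e1 -e2 opprD addrACA.
  exact: gen (h1 x) (h2 x).
have conjB (a b : R[i]) : a^* = a -> b^* = b -> (a - b)^* = a - b.
  by move=> ha hb; rewrite rmorphB /= ha hb.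
case: us1 => uA1 c1 r1; case: us2 => uA2 c2 r2; split.
- by move=> un /=; rewrite uA1// uA2// subrr.
- apply: c0_eqP => x.
  have c1x : (u1.1 x : R[i])^* = u1.1 x by exact: (congr1 (fun a : A => a x) c1).
  have c2x : (u2.1 x : R[i])^* = u2.1 x by exact: (congr1 (fun a : A => a x) c2).
  exact: conjB c1x c2x.
- exact: conjB r1 r2.
Qed.

(** The extension of a state to [C0 + R]. Choosing a representative of the
    function, rather than using the pairs of [usa], treats the unital and the
    non unital case at once; [mean_represents] shows that the choice is
    immaterial. *)
Definition mean (phi : A -> C) w : R :=
  complex.Re (uext phi (xget (0, 0) [set u | represents u w])).

Section State.
Context (phi : {ptws A -> C}) (sphi : states phi).

Let phiL (c : R[i]) a b : phi (c *: a + b) = c * phi a + phi b.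
Proof. by case: sphi => phiL _ _; exact: phiL. Qed.

Let phi0 : phi 0 = 0.
Proof. by have := phiL (-1) 0 0; rewrite scaler0 addr0 mulN1r addNr. Qed.

Let phiZ (c : R[i]) a : phi (c *: a) = c * phi a.
Proof. by rewrite -[c *: a]addr0 phiL phi0 addr0. Qed.

Let phiD a b : phi (a + b) = phi a + phi b.
Proof. by rewrite -[a]scale1r phiL mul1r scale1r. Qed.

Let I f := complex.Re (phi (rC0 f)).

Let phi_ge0 f : isC0 f -> (forall x, 0 <= f x) -> 0 <= phi (rC0 f).
Proof.
move=> f0 fge; have /c0_positiveP[b ->] : forall x, 0 <= (rC0 f x : R[i]).
  by move=> x; rewrite rC0E// ler0c.
by case: sphi => _ phip _; exact: phip.
Qed.

Let maxN f : f = (fun x => Num.max 0 (f x)) \+ (-1 \*o (fun x => Num.max 0 ((-1 \*o f) x))).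
Proof.
by apply/funext => x /=; rewrite !mulN1r /Num.max; case: ltP => h5; case: ltP => h6; lra.
Qed.

Let phiE f : isC0 f -> phi (rC0 f) = (I f)%:C.
Proof.
move=> f0; suff [t pt] : exists t : R, phi (rC0 f) = t%:C by rewrite /I pt.
have p0 := isC0_pos f0; have n0 := isC0_pos (isC0Z (-1) f0).
rewrite (maxN f) rC0D//; last exact: isC0Z.
rewrite rC0Z// phiD phiZ.
have p1 : 0 <= phi (rC0 (fun x => Num.max 0 (f x))).
  by apply: phi_ge0 => // x; rewrite le_max lexx.
have n1 : 0 <= phi (rC0 (fun x => Num.max 0 ((-1 \*o f) x))).
  by apply: phi_ge0 => // x; rewrite le_max lexx.
rewrite -(RRe_real (ger0_real p1)) -(RRe_real (ger0_real n1)).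
set s := complex.Re _; set t := complex.Re _.
by exists (s + -1 * t); rewrite (rmorphD (real_complex R)) (rmorphM (real_complex R)).
Qed.

Let I_ge0 f : isC0 f -> (forall x, 0 <= f x) -> 0 <= I f.
Proof. by move=> f0 fge; rewrite -ler0c -phiE//; exact: phi_ge0. Qed.

Let ID f g : isC0 f -> isC0 g -> I (f \+ g) = I f + I g.
Proof. by move=> f0 g0; rewrite /I rC0D// phiD raddfD. Qed.

Let IZ t f : isC0 f -> I (t \*o f) = t * I f.
Proof. by move=> f0; rewrite /I rC0Z// phiZ phiE//= mul0r subr0. Qed.

Let I_le f g : isC0 f -> isC0 g -> (forall x, f x <= g x) -> I f <= I g.
Proof.
move=> f0 g0 fg; have := I_ge0 (isC0D g0 (isC0Z (-1) f0)).
rewrite ID//; last exact: isC0Z.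
by rewrite IZ// mulN1r subr_ge0; apply => x /=; rewrite mulN1r subr_ge0.
Qed.

Let state_ball a : `|a| <= 1 -> rnorm (phi a) <= 1.
Proof.
move=> a1; case: sphi => _ _ n1; rewrite -lee_fin -n1.
by apply: nnsup_ub; exists a.
Qed.

Lemma state_bounded a : rnorm (phi a) <= supnorm a.
Proof.
have [a0|] := eqVneq (supnorm a) 0.
  have -> : a = 0.
    apply: c0_eqP => x; apply: rnorm_eq0; apply/eqP.
    by rewrite eq_le rnorm_ge0 andbT -a0 supnorm_ge.
  by rewrite phi0 rnorm0 supnorm_ge0.
move=> n0; have np : 0 < supnorm a by rewrite lt_neqAle eq_sym n0 supnorm_ge0.
have : rnorm (phi ((supnorm a)^-1%:C *: a)) <= 1.
  apply: state_ball; rewrite normrZ c0_normE.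
  rewrite [`|_|](_ : _ = (supnorm a)^-1%:C); last first.
    by rewrite ger0_norm// ler0c invr_ge0 ltW.
  by rewrite -(rmorphM (real_complex R)) mulVf.
rewrite phiZ rnormM rnorm_real gtr0_norm ?invr_gt0//.
by rewrite mulrC ler_pdivrMr// mul1r.
Qed.

(** The norm of a state is its value at the unit: if [c] is the phase for which
    [phi (c a) = |phi a|], then [|phi a|] is the value of the state at the real
    part of [c a], which is at most 1 when [a] is in the unit ball. *)
Let state_cst : compact [set: X] -> I (fun=> 1) = 1.
Proof.
move=> cX; have c0 : isC0 (fun _ : X => 1 : R) by exact: isC0_cst.
apply/eqP; rewrite eq_le; apply/andP; split.
  rewrite (le_trans (ler_norm _))// (le_trans (Re_le_rnorm _))//.
  apply: state_ball; rewrite c0_normE lecR; apply: supnorm_rC0_le => //.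
  by move=> x; rewrite normr1.
rewrite -lee_fin; case: sphi => _ _ <-; apply: nnsup_le.
  by rewrite lee_fin; apply: I_ge0.
move=> _ [a a1 <-]; rewrite lee_fin.
have [->|z0] := eqVneq (rnorm (phi a)) 0; first exact: I_ge0.
have zp : 0 < rnorm (phi a) by rewrite lt_neqAle eq_sym z0 rnorm_ge0.
pose c : R[i] := (rnorm (phi a))^-1%:C * (phi a : R[i])^*.
have cE : c * phi a = (rnorm (phi a))%:C.
  rewrite /c -mulrA [X in _ * X]mulrC -sqr_normc -(rnormE (phi a)) expr2.
  by rewrite -!(rmorphM (real_complex R)) mulKf.
have cn : rnorm (c : C) = 1.
  by rewrite rnormM rnorm_real rnormJ gtr0_norm ?invr_gt0// mulVf.
have -> : rnorm (phi a) = I (fun x => complex.Re ((c *: a : A) x)).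
  have : phi (c *: a) = (rnorm (phi a))%:C by rewrite phiZ.
  rewrite {1}(c0_ReIm (c *: a)) phiD phiZ !phiE; [|exact: isC0_Im|exact: isC0_Re].
  have reE (s t r : R) : s%:C + 'i%C * t%:C = r%:C -> r = s by case; lra.
  exact: reE.
apply: I_le => // [|x]; first exact: isC0_Re.
rewrite (le_trans (ler_norm _))// (le_trans (Re_le_rnorm _))//.
change (rnorm (c * a x : C) <= 1); rewrite rnormM cn mul1r.
by apply: le_trans (supnorm_ge a x) _; rewrite -lecR.
Qed.

Let phiB a b : phi (a - b) = phi a - phi b.
Proof. by rewrite -scaleN1r phiD phiZ mulN1r. Qed.

Let uextB u1 u2 : uext phi (u1 - u2) = uext phi u1 - uext phi u2.
Proof. by rewrite /uext /= phiB opprD addrACA. Qed.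

Let uext_ge0 u w : represents u w -> (forall x, 0 <= w x) -> 0 <= uext phi u.
Proof.
move=> uw w0; have [l [f0 u1 u2]] := representsE uw.
set f := fun x => w x - l in f0 u1.
rewrite /uext u1 u2 phiE// -(rmorphD (real_complex R)) ler0c.
have [l0|l0] := leP 0 l.
  have pI := isC0_pos f0; have nI := isC0_pos (isC0Z (-1) f0).
  rewrite (maxN f) ID//; last exact: isC0Z.
  rewrite IZ// mulN1r.
  have : 0 <= I (fun x => Num.max 0 (f x)) by apply: I_ge0 => // x; rewrite le_max lexx.
  have : I (fun x => Num.max 0 ((-1 \*o f) x)) <= l.
    rewrite (le_trans (ler_norm _))// (le_trans (Re_le_rnorm _))//.
    rewrite (le_trans (state_bounded _))//; apply: supnorm_rC0_le => // x.
    rewrite ger0_norm ?le_max ?lexx// ge_max l0 /= /f; have := w0 x; lra.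
  lra.
(* A negative scalar part forces X to be compact, and then the algebra is
   unital and the scalar part vanishes. *)
have cX : compact [set: X].
  apply: (@isC0_gt_compact _ _ f (- l)) => //; first by lra.
  by move=> x; rewrite (le_trans _ (ler_norm _))// /f; have := w0 x; lra.
have := uw.1; case => /(_ (compact_unital cX)); rewrite u2 => /complexI l00.
by rewrite l00 ltxx in l0.
Qed.

(** Two representatives of [w] differ by a representative of 0, which is
    nonnegative with both signs. *)
Lemma mean_represents u w : represents u w -> uext phi u = (mean phi w)%:C.
Proof.
move=> uw; rewrite /mean; set u' := xget _ _.
have uw' : represents u' w by exact: (@xgetI _ (0, 0) [set v | represents v w] u uw).
have h (v v' : A * C) : represents v w -> represents v' w -> 0 <= uext phi v - uext phi v'.
  move=> vw vw'; rewrite -uextB; apply: uext_ge0 (representsB vw vw') _ => x.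
  by rewrite subrr.
have -> : uext phi u = uext phi u'.
  apply: (@le_anti _ R[i]); apply/andP.
  by split; rewrite -(@subr_ge0 R[i]); exact: h.
have [l [w0 u1 u2]] := representsE uw'.
by rewrite /uext u1 u2 phiE// -(rmorphD (real_complex R)).
Qed.

Lemma mean_C0 f : isC0 f -> phi (rC0 f) = (mean phi f)%:C.
Proof. by move=> /represents_rC0/mean_represents <-; rewrite /uext /= addr0. Qed.

Lemma mean_sub w1 w2 : isuC0 w1 -> isuC0 w2 ->
  mean phi (fun x => w1 x - w2 x) = mean phi w1 - mean phi w2.
Proof.
move=> /represents_exists[u1 h1] /represents_exists[u2 h2]; apply: complexI.
rewrite -(mean_represents (representsB h1 h2)) uextB.
by rewrite (mean_represents h1) (mean_represents h2) (rmorphB (real_complex R)).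
Qed.

Lemma mean_ge0 w : isuC0 w -> (forall x, 0 <= w x) -> 0 <= mean phi w.
Proof.
by move=> /represents_exists[u uw] w0; rewrite -ler0c -(mean_represents uw); exact: uext_ge0 uw w0.
Qed.

Lemma mean_le w1 w2 : isuC0 w1 -> isuC0 w2 -> (forall x, w1 x <= w2 x) ->
  mean phi w1 <= mean phi w2.
Proof.
move=> c1 c2 w12; rewrite -subr_ge0 -mean_sub//; apply: mean_ge0.
  exact: isuC0B.
by move=> x; rewrite subr_ge0.
Qed.

Lemma mean_D w1 w2 : isuC0 w1 -> isuC0 w2 -> mean phi (w1 \+ w2) = mean phi w1 + mean phi w2.
Proof.
move=> c1 c2; have := mean_sub (isuC0D c1 c2) c2.
rewrite (_ : (fun x => _) = w1); first by move=> ->; rewrite subrK.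
by apply/funext => x /=; rewrite addrK.
Qed.

Lemma mean_1 : mean phi (fun=> 1) = 1.
Proof.
have [un|nun] := pselect (unital A).
  have cX := unital_compact lc un; have c0 := @isC0_cst _ _ 1 cX.
  by apply: complexI; rewrite -mean_C0// phiE// state_cst.
have r1 : represents (0, 1) (fun=> 1).
  split; last by move=> x; exact: add0r.
  split => //=; last exact: conjc1.
  by apply: c0_eqP => x; exact: conjc0.
by apply: complexI; rewrite -(mean_represents r1) /uext /= phi0 add0r.
Qed.

Lemma mean_Z t w : isuC0 w -> mean phi (t \*o w) = t * mean phi w.
Proof.
move=> c1; have [u uw] := represents_exists c1; have [l [f0 u1 u2]] := representsE uw.
have tw : represents (rC0 (t \*o (fun x => w x - l)), (t * l)%:C) (t \*o w).
  have tf0 := isC0Z t f0; split => [|x]; last first.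
    by rewrite /= rC0E// -(rmorphD (real_complex R)) /= -mulrDr subrK.
  split => /=; [|exact: rC0_selfadj|exact: conjc_real].
  move=> un; have := uw.1; case => /(_ un); rewrite u2 => /complexI -> _ _.
  by rewrite mulr0.
apply: complexI; rewrite -(mean_represents tw) /uext /= rC0Z// phiZ.
have : uext phi u = (mean phi w)%:C by exact: mean_represents.
rewrite /uext u1 u2 => wE; rewrite (rmorphM (real_complex R)) -mulrDr wE.
exact/esym/(rmorphM (real_complex R)).
Qed.

Lemma mean_abs w (v : X -> R) : isuC0 w -> isuC0 v -> (forall x, `|w x| <= v x) ->
  `|mean phi w| <= mean phi v.
Proof.
move=> cw cv wv; rewrite ler_norml; apply/andP; split.
  rewrite -mulN1r -mean_Z//; apply: mean_le => //; first exact: isuC0Z.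
  by move=> x; rewrite /= mulN1r; have := wv x; rewrite ler_norml => /andP[].
by apply: mean_le => // x; exact: le_trans (ler_norm _) (wv x).
Qed.

Lemma mean_cst c : mean phi (fun=> c) = c.
Proof.
rewrite (_ : (fun _ => c) = c \*o (fun _ : X => 1)).
  by rewrite mean_Z ?mean_1 ?mulr1//; exact: isuC0_cst.
by apply/funext => x /=; rewrite mulr1.
Qed.

(** A state that gives full mass to a set of small diameter is close, on a
    Lipschitz function, to the evaluation at a point of that set. *)
Lemma mean_localized k x0 (r : R) w : isC0 k -> (forall x, 0 <= k x <= 1) ->
  (forall x, k x != 0 -> mdist x0 x <= r) -> 0 <= r -> 1 <= mean phi k ->
  isuC0 w -> lipr 1 w -> `|mean phi w - w x0| <= r.
Proof.
move=> k0 k01 kr r0 Ek cw lw; have ck := isC0_isuC0 k0.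
have cw' : isuC0 (fun x => w x - w x0).
  by apply: isuC0B => //; exact: isuC0_cst.
have [B B0 hB] := isuC0_bounded cw'.
pose B' := Num.max B r.
have B'B : B <= B' by rewrite le_max lexx.
have B'r : r <= B' by rewrite le_max lexx orbT.
have wE : mean phi (fun x => w x - w x0) = mean phi w - w x0.
  by rewrite mean_sub// ?mean_cst//; exact: isuC0_cst.
rewrite -wE; pose v := ((r - B') \*o k) \+ (fun=> B').
have cv : isuC0 v by apply: isuC0D; [exact: isuC0Z|exact: isuC0_cst].
apply: (@le_trans _ _ (mean phi v)).
  apply: mean_abs => // x; rewrite /v /=; have /andP[kx0 kx1] := k01 x.
  have [->|kx] := eqVneq (k x) 0; first by rewrite mulr0 add0r (le_trans (hB x)).
  have := kr _ kx; have := lw x0 x; rewrite mul1r distrC => h1 h2; nra.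
rewrite mean_D; [|exact: isuC0Z|exact: isuC0_cst].
by rewrite mean_Z// mean_cst; nra.
Qed.

End State.

End States.

(** * Local states, compressions and regularity *)

Section Regular.
Context {R : realType} {X : metricType R}.
Hypothesis lc : locally_compact [set: X].
Local Notation C := (Cplx R).
Local Notation A := (C0 R X).
Local Notation L := (unit_ext (@Lip R X)).
Implicit Types (f g k w : X -> R) (a b : A) (phi psi : {ptws A -> C}).

Lemma states_on_real_majorant (K : set {ptws [set: A] -> C}) phi k : compacts K ->
  states_on K phi -> real_majorant K k -> 1 <= mean phi k.
Proof.
move=> cK [sphi phi1] Kk.
have [|||I [IE Ile _]] := @indicator_mono _ _ lc K (fun a : [set: A] => phi (val a)) (mean phi) cK.
- by move=> q [q0 _ _]; rewrite /= mean_C0.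
- by move=> q [q0 qge _]; apply: mean_ge0 => //; exact: isC0_isuC0.
- by move=> q q' [q0 _ _] [q'0 _ _]; apply: mean_le => //; exact: isC0_isuC0.
have : I%:C = 1%:C by rewrite -IE; exact: phi1.
by move=> /complexI I1; rewrite -I1; exact: Ile.
Qed.

(** For [w >= 0], both limits in the Arens product are along functionals that
    are monotone on the majorants, hence infima by [indicator_mono]; taking the
    same majorant [k] in both gives the bound. *)
Lemma compression_le (K : set {ptws [set: A] -> C}) phi u w : compacts K ->
  states phi -> represents u w -> (forall x, 0 <= w x) ->
  exists2 c : R, compression K u phi = c%:C &
    forall k, real_majorant K k -> c <= mean phi (w \* (k \* k)).
Proof.
move=> cK sphi uw w0; have [l [wl u1 u2]] := representsE uw.
have cw : isuC0 w by exists l.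
have umE k : isC0 k -> umul u (rC0 k) = rC0 (w \* k).
  move=> k0; apply: rC0_of => x.
  change (u.1 x * rC0 k x + u.2 * rC0 k x = (w x * k x)%:C).
  by rewrite -mulrDl (uw.2 x) rC0E//; exact/esym/(rmorphM (real_complex R)).
have inner k : real_majorant K k -> exists I : R,
    [/\ indicator K (fun b : [set: A] => phi (rC0 k ** umul u (val b))) = I%:C,
       forall k', real_majorant K k' -> I <= mean phi (k \* (w \* k')) &
       forall c, (forall k', real_majorant K k' -> c <= mean phi (k \* (w \* k'))) -> c <= I].
  move=> [k0 kge kK].
  apply: (@indicator_mono _ _ lc K _ (fun k' => mean phi (k \* (w \* k'))) cK).
  - move=> q [q0 _ _]; have wq0 := isuC0M cw q0.
    by rewrite /= umE// -rC0M// mean_C0//; exact: isC0M.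
  - move=> q [q0 qge _]; apply: mean_ge0 => //.
      by apply: isC0_isuC0; apply: isC0M => //; exact: isuC0M.
    by move=> x /=; rewrite !mulr_ge0.
  - move=> q q' [q0 _ _] [q'0 _ _] qq'; apply: mean_le => //.
    + by apply: isC0_isuC0; apply: isC0M => //; exact: isuC0M.
    + by apply: isC0_isuC0; apply: isC0M => //; exact: isuC0M.
    + by move=> x /=; rewrite !ler_wpM2l.
pose F k := complex.Re (indicator K (fun b : [set: A] => phi (rC0 k ** umul u (val b)))).
have FE k : real_majorant K k -> [/\ indicator K (fun b : [set: A] => phi (rC0 k ** umul u (val b))) = (F k)%:C,
       forall k', real_majorant K k' -> F k <= mean phi (k \* (w \* k')) &
       forall c, (forall k', real_majorant K k' -> c <= mean phi (k \* (w \* k'))) -> c <= F k].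
  by move=> Kk; have [I [IE I1 I2]] := inner k Kk; rewrite /F IE.
have [|||c [cE cle _]] := @indicator_mono _ _ lc K
  (fun a : [set: A] => indicator K (fun b : [set: A] => phi (val a ** umul u (val b)))) F cK.
- by move=> k Kk; have [] := FE k Kk.
- move=> k Kk; have [_ _] := FE k Kk; apply=> k' [k'0 k'ge _].
  have [k0 kge _] := Kk; apply: mean_ge0 => //.
    by apply: isC0_isuC0; apply: isC0M => //; exact: isuC0M.
  by move=> x /=; rewrite !mulr_ge0.
- move=> k k' Kk Kk' kk'; have [_ _] := FE k' Kk'; apply=> q Kq.
  have [_ /(_ q Kq) h _] := FE k Kk; apply: (le_trans h).
  have [k0 _ _] := Kk; have [k'0 _ _] := Kk'; have [q0 qge _] := Kq.
  apply: mean_le => //.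
  + by apply: isC0_isuC0; apply: isC0M => //; exact: isuC0M.
  + by apply: isC0_isuC0; apply: isC0M => //; exact: isuC0M.
  + by move=> x /=; rewrite ler_wpM2r// mulr_ge0.
exists c; first exact: cE.
move=> k Kk; apply: (le_trans (cle k Kk)); have [_ /(_ k Kk) h _] := FE k Kk.
rewrite (_ : w \* (k \* k) = k \* (w \* k))//.
by apply/funext => x /=; rewrite mulrCA.
Qed.

Lemma mk_ge phi psi f : states phi -> states psi -> isC0 f -> lipr 1 f ->
  (`|mean phi f - mean psi f|%:E <= mk L phi psi)%E.
Proof.
move=> sphi spsi f0 fl; apply: nnsup_ub; exists (rC0 f).
  by split; [exact: rC0_selfadj|exact/(Lip_rC0 f0 ler01)].
by rewrite !mean_C0// -(rmorphB (real_complex R)) rnorm_real.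
Qed.

Lemma mk_le phi psi (t : R) : states phi -> states psi -> 0 <= t ->
  (forall f, isC0 f -> lipr 1 f -> `|mean phi f - mean psi f| <= t) ->
  (mk L phi psi <= t%:E)%E.
Proof.
move=> sphi spsi t0 ht; apply: nnsup_le; first by rewrite lee_fin.
move=> y [a [sa La] <-]; have aE := (c0_selfadjP a).1 sa.
have f0 := isC0_Re a; move: La; rewrite /unit_ext /= aE => /(Lip_rC0 f0 ler01) fl.
rewrite lee_fin (mean_C0 sphi f0) (mean_C0 spsi f0).
by rewrite -(rmorphB (real_complex R)) rnorm_real; exact: ht.
Qed.

(** A bump over [K] carries every state of [states_on K], and its support has
    finite radius, so [mean_localized] applies with one point [x0]. *)
Lemma Lip_regular : regular_triple L [set: A].
Proof.
split; first by split; [exact: Lip_lipschitz_pair|exact: C0_topographic].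
move=> K cK; have [k [D [Kk k0 cD kP]]] := exists_real_majorant lc cK.
have [[x0 kx0]|nx] := pselect (exists x0, k x0 != 0); last first.
  (* The bump is 0, so no state is carried by [K]. *)
  apply: le_lt_trans (ltry 0); apply: nnsup_le => // _ [phi Kphi [psi _ <-]].
  have := states_on_real_majorant cK Kphi Kk.
  rewrite (_ : k = fun=> 0); first by case: Kphi => sphi _; rewrite mean_cst// ler10.
  by apply/funext => x; apply: contrapT => /eqP kx; apply: nx; exists x.
have [r r0 hr] := compact_mdist_bounded x0 cD.
apply: le_lt_trans (ltry (r + r)); apply: nnsup_le.
  by rewrite lee_fin addr_ge0.
have loc phi f : states_on K phi -> isC0 f -> lipr 1 f -> `|mean phi f - f x0| <= r.
  move=> Kphi f0 fl; have [sphi _] := Kphi.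
  apply: (mean_localized lc sphi k0) => //.
  - by move=> x; case: (kP x).
  - move=> x kx; apply: hr; apply: contrapT => /(kP x).2 kx0'.
    by rewrite kx0' eqxx in kx.
  - exact: states_on_real_majorant Kk.
  - exact: isC0_isuC0.
move=> _ [phi Kphi [psi Kpsi <-]]; have [sphi _] := Kphi; have [spsi _] := Kpsi.
apply: mk_le => // [|f f0 fl]; first by rewrite addr_ge0.
have := loc _ _ Kphi f0 fl; have := loc _ _ Kpsi f0 fl.
rewrite !ler_norml => /andP[h1 h2] /andP[h3 h4]; apply/andP; split; lra.
Qed.

End Regular.

(** * Equicontinuity *)

Section Ascoli.
Context {R : realType} {X : metricType R}.
Local Notation C := (Cplx R).
Local Notation A := (C0 R X).
Implicit Types (f g k : X -> R) (w : {ptws X -> R}) (phi psi : {ptws A -> C}).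

(** The 1-Lipschitz functions with [|w x0| <= r] satisfy the second condition;
    it is stated at every [x] so that the set lies in a product of segments. *)
Definition lipball (x0 : X) (r : R) : set {ptws X -> R} :=
  [set w | lipr 1 w /\ forall x, `|w x| <= r + mdist x0 x].

Lemma lipball_compact x0 r : compact (lipball x0 r).
Proof.
pose I x := `[- (r + mdist x0 x), r + mdist x0 x]%classic : set R.
have cI : compact [set w : {ptws X -> R} | forall x, I x (w x)].
  by apply: (@tychonoff X (fun=> R) I) => x; exact: segment_compact.
apply: (subclosed_compact _ cI); last first.
  by move=> w [_ hw] x; rewrite /I /= in_itv /= -ler_norml.
move=> w clw.
have near_w (x y : X) (e : R) : 0 < e -> exists2 w', lipball x0 r w' &
    `|w x - w' x| < e /\ `|w y - w' y| < e.
  move=> e0.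
  have nb : nbhs w [set w' : {ptws X -> R} | `|w x - w' x| < e /\ `|w y - w' y| < e].
    exact: (@filterI _ (nbhs w) (@nbhs_filter _ w) _ _
      (near_ptws_real w x e0) (near_ptws_real w y e0)).
  by have [w' [lw' h]] := clw _ nb; exists w'.
split=> [x y|x]; apply/ler_addgt0Pr => e e0.
  have [|w' [lw' _] [h1 h2]] := near_w x y (e / 2); first by rewrite divr_gt0.
  have := lw' x y; rewrite !ltr_norml !ler_norml in h1 h2 *.
  move: h1 h2 => /andP[h1 h2] /andP[h3 h4] /andP[h5 h6].
  by apply/andP; split; lra.
have [w' [_ lw'] [h1 _]] := near_w x x e e0.
have := lw' x; rewrite !ltr_norml !ler_norml in h1 *.
move: h1 => /andP[h1 h2] /andP[h3 h4].
by apply/andP; split; lra.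
Qed.

(** Equicontinuity makes pointwise convergence locally uniform. *)
Lemma near_lipr w (D : set X) (e : R) : compact D -> 0 < e -> lipr 1 w ->
  \forall w' \near w, lipr 1 w' -> forall x, D x -> `|w' x - w x| <= e.
Proof.
move=> cD e0 lw; have FF : Filter (nbhs w) := @nbhs_filter _ w.
have : \forall w' \near w, D `<=` [set x | lipr 1 w' -> `|w' x - w x| <= e].
  apply: ((compact_near_coveringP D).1 cD _ (nbhs w)
    (fun (w' : {ptws X -> R}) x => lipr 1 w' -> `|w' x - w x| <= e) FF) => x _.
  have e3 : 0 < e / 3 by rewrite divr_gt0.
  exists ([set x' | mdist x x' < e / 3], [set w' : {ptws X -> R} | `|w x - w' x| < e / 3]).
    by split; [exact: near_mdist|exact: near_ptws_real].
  move=> [x' w'] /= [xx' ww'] lw'; have := lw x x'; have := lw' x x'.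
  rewrite !mul1r !ler_norml; move: ww'; rewrite ltr_norml.
  by move=> /andP[h1 h2] /andP[h3 h4] /andP[h5 h6]; apply/andP; split; lra.
apply: (@filterS _ (nbhs w) FF) => w' h lw' x Dx; exact: h.
Qed.

Hypothesis lc : locally_compact [set: X].

Lemma isC0_lipM w k (D : set X) : lipr 1 w -> isC0 k -> compact D ->
  (forall x, ~ D x -> k x = 0) -> isC0 (w \* k).
Proof.
move=> lw k0 cD kD; apply: (isC0_support _ cD) => [x|x /kD kx]; last first.
  by rewrite /= kx mulr0.
by apply: cvgM; [exact: lipr_continuous lw x|exact: k0.1].
Qed.

(** For a single [w] this is the definition of the weak* topology. By
    [near_lipr], functions that are pointwise close to [w] stay uniformly close
    after multiplication by [k], and states do not increase the uniform norm;
    compactness of [lipball x0 r] then gives one neighbourhood for all [w]. *)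
Lemma near_states phi k (D : set X) x0 (r e : R) : states phi -> isC0 k ->
  (forall x, 0 <= k x <= 1) -> compact D -> (forall x, ~ D x -> k x = 0) ->
  0 < e ->
  \forall psi \near phi, states psi -> forall w, lipball x0 r w ->
    `|mean phi (w \* k) - mean psi (w \* k)| <= e.
Proof.
move=> sphi k0 k01 cD kD e0; have FF : Filter (nbhs phi) := @nbhs_filter _ phi.
have e3 : 0 < e / 3 by rewrite divr_gt0.
have : \forall psi \near phi, lipball x0 r `<=`
    [set w | states psi -> `|mean phi (w \* k) - mean psi (w \* k)| <= e].
  apply: ((near_covering_withinP _).2
    ((compact_near_coveringP _).1 (@lipball_compact x0 r)) _ (nbhs phi)
    (fun (psi : {ptws A -> C}) w => states psi ->
       `|mean phi (w \* k) - mean psi (w \* k)| <= e) FF) => w [lw _].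
  have wk0 := isC0_lipM lw k0 cD kD.
  exists ([set w' : {ptws X -> R} | lipr 1 w' -> forall x, D x -> `|w' x - w x| <= e / 3],
          [set psi : {ptws A -> C} | rnorm (phi (rC0 (w \* k)) - psi (rC0 (w \* k)) : C) < e / 3]).
    by split; [exact: near_lipr|exact: near_ptws_cplx].
  move=> [w' psi] /= [ww' +] [lw' _] spsi.
  rewrite !mean_C0// -(rmorphB (real_complex R)) rnorm_real.
  have w'k0 := isC0_lipM lw' k0 cD kD.
  have close (chi : {ptws A -> C}) : states chi ->
      `|mean chi (w' \* k) - mean chi (w \* k)| <= e / 3.
    move=> schi; have c1 := isC0_isuC0 w'k0; have c2 := isC0_isuC0 wk0.
    rewrite -mean_sub// -[leRHS](mean_cst lc schi); apply: mean_abs => //.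
    + exact: isuC0B.
    + exact: isuC0_cst.
    + move=> x /=; rewrite -mulrBl normrM.
      have [Dx|/kD ->] := pselect (D x); last by rewrite normr0 mulr0 ltW.
      have /andP[kx0 kx1] := k01 x; rewrite (ger0_norm kx0).
      have := ww' lw' x Dx; have := normr_ge0 (w' x - w x); nra.
  have := close _ sphi; have := close _ spsi.
  rewrite ltr_norml !ler_norml => /andP[h1 h2] /andP[h3 h4] /andP[h5 h6].
  by apply/andP; split; lra.
apply: (@filterS _ (nbhs phi) FF) => psi h spsi w Lw; exact: h.
Qed.

End Ascoli.

(** * Tame sets *)

Section Tame.
Context {R : realType} {X : metricType R}.
Hypothesis lc : locally_compact [set: X].
Local Notation C := (Cplx R).
Local Notation A := (C0 R X).
Local Notation L := (unit_ext (@Lip R X)).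
Implicit Types (f g k w : X -> R) (a b : A) (phi psi mu : {ptws A -> C}).

Lemma mean_vanish mu k w : states mu -> isC0 k -> (forall x, 0 <= k x <= 1) ->
  1 <= mean mu k -> isuC0 w -> (forall x, k x != 0 -> w x = 0) -> mean mu w = 0.
Proof.
move=> smu k0 k01 Ek cw wk; have [B B0 hB] := isuC0_bounded cw.
have ck := isC0_isuC0 k0.
have c1 : isuC0 ((- B \*o k) \+ (fun=> B)).
  by apply: isuC0D; [exact: isuC0Z|exact: isuC0_cst].
have : `|mean mu w| <= mean mu ((- B \*o k) \+ (fun=> B)).
  apply: (mean_abs lc) => // x /=; have /andP[kx0 kx1] := k01 x.
  have [->|/wk ->] := eqVneq (k x) 0; first by rewrite mulr0 add0r.
  by rewrite normr0; nra.
rewrite (mean_D lc)//; [|exact: isuC0Z|exact: isuC0_cst].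
rewrite (mean_Z lc)// (mean_cst lc)// => h.
by apply/normr0_eq0/eqP; rewrite eq_le normr_ge0 andbT; nra.
Qed.

(** Tameness as uniform tightness. With [k1] a bump that carries [mu], every
    1-Lipschitz [w] of mean 0 under [mu] is bounded by [2 r] on the support of
    [k1]. Hence [|w| <= v + 2 r] with [v] the positive part of [|w| - 2 r],
    which vanishes there, and the mean of [|w| (1 - k^2)] is at most the sum of
    that of [v (1 - k^2)] and [2 r] times that of [1 - k^2]. Both are
    small by [mass], which is what tameness says of a nonnegative function. *)
Lemma tame_uniform S : tame L [set: A] S ->
  exists mu x0 r, [/\ states mu, 0 <= r,
    forall w, isuC0 w -> lipr 1 w -> mean mu w = 0 -> `|w x0| <= r &
    forall e : R, 0 < e -> exists k D, [/\ isC0 k, forall x, 0 <= k x <= 1,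
      compact D, forall x, ~ D x -> k x = 0 &
      forall phi w, S phi -> isuC0 w -> lipr 1 w -> mean mu w = 0 ->
        `|mean phi w - mean phi (w \* k)| <= e]].
Proof.
move=> [Ss [mu [K0 cK0 Kmu] tS]]; have [smu _] := Kmu.
have [k1 [D1 [Kk1 k10 cD1 k1P]]] := exists_real_majorant lc cK0.
have Ek1 := states_on_real_majorant lc cK0 Kmu Kk1.
have k101 x : 0 <= k1 x <= 1 by case: (k1P x).
have k1D x : k1 x != 0 -> D1 x.
  by move=> kx; apply: contrapT => /(k1P x).2 kx0; rewrite kx0 eqxx in kx.
have [x0 D1x0] : exists x0, k1 x0 != 0.
  apply: contrapT => nx; move: Ek1; rewrite (_ : k1 = fun=> 0).
    by rewrite (mean_cst lc)// ler10.
  by apply/funext => x; apply: contrapT => /eqP kx; apply: nx; exists x.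
have [r r0 hr] := compact_mdist_bounded x0 cD1.
have loc w : isuC0 w -> lipr 1 w -> mean mu w = 0 -> `|w x0| <= r.
  move=> cw lw w0; rewrite -normrN -[- w x0]add0r -w0.
  by apply: (mean_localized lc smu k10) => // x /k1D; exact: hr.
exists mu, x0, r; split => // e e0.
have [k0 [D0 [n [cD0 n0 lk0 /all_and3[k001 k0D1 k0D0]]]]] := bump lc cD1.
have k00 : isC0 k0 by exact: isC0_support (lipr_continuous lk0) cD0 k0D0.
(* [e / M] bounds the contribution of [v]; that of the mass outside of [K] is
   [2 r] times [n (e / M)], as [(1 - k0) / n] is 1-Lipschitz; they add up to
   [e]. *)
pose M := 1 + r * n *+ 2; have M0 : 0 < M.
  by rewrite /M ltr_pwDl// mulrn_wge0// mulr_ge0// ltW.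
have eM : 0 < e / M by rewrite divr_gt0.
have nb : nbhs (0%E : \bar R) [set y | (y < (e / M)%:E)%E].
  change (nbhs (0 : R) [set t | (t%:E < (e / M)%:E)%E]).
  apply: filterS (nbhsx_ballx (0 : R) _ eM) => t.
  by rewrite -ball_normE /= sub0r normrN lte_fin => /(le_lt_trans (ler_norm _)).
have [K cK hK] := tS _ nb.
(* Beyond [D0] the function [1 - k0] is 1, so that the mean of [1 - k0] outside
   of [K'] is the mass outside of [K']. *)
pose K' := K `|` ev @` D0.
have cK' : compacts K'.
  have [c1 s1] := cK; have [c2 s2] := compacts_ev lc cD0.
  by split; [exact: compactU|move=> x [/s1|/s2]].
have {hK} := hK K' (conj cK' (@subsetUl _ _ _)); rewrite /= => hK.
have [k [D [Kk k'0 cD kP]]] := exists_real_majorant lc cK'.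
have k01 x : 0 <= k x <= 1 by case: (kP x).
have kD0 x : D0 x -> k x = 1.
  move=> Dx; apply/eqP; rewrite eq_le; have [_ _ Kk'] := Kk.
  by have /andP[_ ->] := k01 x; apply: Kk'; right; exists x.
have kk0 : isC0 (k \* k) by exact: isC0M.
have kk01 x : 0 <= (k \* k) x <= 1.
  by have /andP[h1 h2] := k01 x; rewrite /= mulr_ge0// mulr_ile1.
exists (k \* k), D; split => //.
  by move=> x /(kP x).2 kx; rewrite /= kx mulr0.
have mass w phi : S phi -> isuC0 w -> lipr 1 w -> (forall x, 0 <= w x) ->
    mean mu w = 0 -> mean phi w - mean phi (w \* (k \* k)) <= e / M.
  move=> Sphi cw lw wge w0; have [u uw] := represents_exists lc cw.
  have sphi := Ss _ Sphi.
  have [c cE cle] := compression_le lc cK' sphi uw wge.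
  have lu : lip1 L mu u.
    have [l [wl u1 u2]] := representsE uw; split; first by case: uw.
      rewrite /unit_ext u1; apply/(Lip_rC0 wl ler01) => x y.
      by rewrite opprB addrA subrK; exact: lw.
    by rewrite (mean_represents smu uw) w0.
  have : ((rnorm (uext phi u - compression K' u phi))%:E < (e / M)%:E)%E.
    by apply: le_lt_trans hK; apply: nnsup_ub; exists u => //; exists phi.
  rewrite (mean_represents sphi uw) cE -(rmorphB (real_complex R)) rnorm_real lte_fin.
  by have := cle k Kk; rewrite ltr_norml => h1 /andP[h2 h3]; lra.
have tight phi : S phi -> 1 - mean phi (k \* k) <= n * (e / M).
  move=> Sphi; have sphi := Ss _ Sphi.
  pose w0 := n^-1 \*o ((-1 \*o k0) \+ (fun=> 1)).
  have ck0 := isC0_isuC0 k00.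
  have cw0 : isuC0 w0.
    apply: isuC0Z; apply: isuC0D; [exact: isuC0Z|exact: isuC0_cst].
  have lw0 : lipr 1 w0.
    move=> x y; rewrite /w0 /= -mulrBr normrM gtr0_norm ?invr_gt0//.
    rewrite ler_pdivrMl// mul1r !mulN1r.
    have -> : - k0 x + 1 - (- k0 y + 1) = k0 y - k0 x by lra.
    by rewrite (metric_sym x).
  have w0ge x : 0 <= w0 x.
    have /andP[h1 h2] := k001 x; apply: mulr_ge0; first by rewrite invr_ge0 ltW.
    by rewrite /= mulN1r; lra.
  have mw0 : mean mu w0 = 0.
    apply: (mean_vanish smu k10) => // x /k1D/k0D1 kx.
    by rewrite /w0 /= kx mulr1 addNr mulr0.
  have := mass w0 phi Sphi cw0 lw0 w0ge mw0.
  have cp : isuC0 (w0 \* (k \* k)) by apply: isC0_isuC0; exact: isuC0M.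
  rewrite -(mean_sub lc)//.
  have -> : (fun x => w0 x - (w0 \* (k \* k)) x) =
      n^-1 \*o (fun x => 1 - (k \* k) x).
    apply/funext => x; rewrite /w0 /=.
    have [/kD0 ->|/k0D0 ->] := pselect (D0 x); first by lra.
    by lra.
  rewrite (mean_Z lc)//; last first.
    by apply: isuC0B; [exact: isuC0_cst|exact: isC0_isuC0].
  rewrite (mean_sub lc) ?(mean_1 lc)//; [|exact: isuC0_cst|exact: isC0_isuC0].
  by rewrite ler_pdivrMl.
move=> phi w Sphi cw lw w0; have sphi := Ss _ Sphi.
pose th (t : R) := Num.max 0 (`|t| - r *+ 2).
have thL s t : `|th s - th t| <= `|s - t|.
  have h1 := ler_dist_dist s t; rewrite ler_norml in h1; case/andP: h1 => h1 h2.
  rewrite /th ler_norml /Num.max; case: ltP => h3; case: ltP => h4;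
    have := normr_ge0 (s - t); move=> h5; apply/andP; split; lra.
have cv := isuC0_comp thL cw; set v := th \o w in cv.
have lv : lipr 1 v by move=> x y; exact: le_trans (thL _ _) (lw x y).
have vge x : 0 <= v x by rewrite /v /th /= le_max lexx.
have mv : mean mu v = 0.
  apply: (mean_vanish smu k10) => // x /k1D/hr xr.
  rewrite /v /th /=; apply/max_idPl; rewrite subr_le0.
  have := loc w cw lw w0; have := lw x0 x; rewrite mul1r mulr2n.
  have := ler_normB (w x0) (w x0 - w x); rewrite opprB addrC subrK; lra.
have := mass v phi Sphi cv lv vge mv; have := tight phi Sphi.
have cvk : isuC0 (v \* (k \* k)) by apply: isC0_isuC0; exact: isuC0M.
have cwk : isuC0 (w \* (k \* k)) by apply: isC0_isuC0; exact: isuC0M.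
have ckk : isuC0 (k \* k) by exact: isC0_isuC0.
rewrite -[X in X - mean phi (k \* k)](mean_1 lc sphi) -!(mean_sub lc)//; last exact: isuC0_cst.
move=> h1 h2.
have c1 : isuC0 (fun x => 1 - (k \* k) x) by apply: isuC0B => //; exact: isuC0_cst.
have c2 : isuC0 (fun x => v x - (v \* (k \* k)) x) by exact: isuC0B.
apply: (@le_trans _ _ (mean phi ((fun x => v x - (v \* (k \* k)) x) \+
                         (r *+ 2 \*o (fun x => 1 - (k \* k) x))))).
  apply: (mean_abs lc) => //; [exact: isuC0B|by apply: isuC0D => //; exact: isuC0Z|].
  move=> x /=; have /andP[k0x k1x] := kk01 x; rewrite /= in k0x k1x.
  have -> : w x - w x * (k x * k x) = w x * (1 - k x * k x) by lra.
  rewrite normrM (ger0_norm (_ : 0 <= 1 - k x * k x)) ?subr_ge0//.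
  have : `|w x| <= v x + r *+ 2 by rewrite -lerBlDr /v /th /= le_max lexx orbT.
  by move=> h; nra.
rewrite (mean_D lc)//; last exact: isuC0Z.
rewrite (mean_Z lc)//.
apply: (@le_trans _ _ (e / M + r *+ 2 * (n * (e / M)))).
  by apply: lerD => //; apply: ler_wpM2l => //; rewrite mulrn_wge0.
have -> : e / M + r *+ 2 * (n * (e / M)) = M * (e / M) by rewrite /M; ring.
by rewrite mulrC divfK// gt_eqF.
Qed.

(** A Lipschitz approximation [g] of [f], divided by its Lipschitz constant (plus
    1, which keeps the divisor positive), competes in the definition of the
    distance. *)
Lemma mk_controls phi f (e : R) : states phi -> isC0 f -> 0 < e ->
  exists2 r : R, 0 < r & forall psi, states psi -> (mk L phi psi < r%:E)%E ->
    `|mean phi f - mean psi f| < e.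
Proof.
move=> sphi f0 e0; have e3 : 0 < e / 3 by rewrite divr_gt0.
have [g [n [g0 n0 lg fg]]] := lip_approx f0 e3.
have n1 : 0 < n + 1 by rewrite ltr_wpDl.
exists (e / 3 / (n + 1)); first by rewrite divr_gt0.
move=> psi spsi mkr.
pose h := (n + 1)^-1 \*o g.
have h0 : isC0 h by exact: isC0Z.
have cg := isC0_isuC0 g0; have cf := isC0_isuC0 f0.
have lh : lipr 1 h.
  move=> x y; rewrite /h /= -mulrBr normrM gtr0_norm ?invr_gt0//.
  rewrite ler_pdivrMl// mul1r (le_trans (lg x y))// ler_wpM2r ?mdist_ge0//.
  by rewrite lerDl.
have := le_lt_trans (mk_ge sphi spsi h0 lh) mkr.
rewrite lte_fin !(mean_Z lc)// -mulrBr normrM gtr0_norm ?invr_gt0//.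
rewrite [ltRHS]mulrC ltr_pM2l ?invr_gt0// => gg.
have close chi : states chi -> `|mean chi f - mean chi g| <= e / 3.
  move=> schi; rewrite -(mean_sub lc)// -[leRHS](mean_cst lc schi).
  by apply: (mean_abs lc) => //; [exact: isuC0B|exact: isuC0_cst].
have := close _ sphi; have := close _ spsi; move: gg.
rewrite !ltr_norml !ler_norml => /andP[h1 h2] /andP[h3 h4] /andP[h5 h6].
by apply/andP; split; lra.
Qed.

Lemma mk_controls_value phi a (e : R) : states phi -> 0 < e ->
  exists2 r : R, 0 < r & forall psi, states psi -> (mk L phi psi < r%:E)%E ->
    rnorm (phi a - psi a : C) < e.
Proof.
move=> sphi e0; have e2 : 0 < e / 2 by rewrite divr_gt0.
have f0 := isC0_Re a; have g0 := isC0_Im a.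
have [r1 r10 h1] := mk_controls sphi f0 e2.
have [r2 r20 h2] := mk_controls sphi g0 e2.
exists (Num.min r1 r2); first by rewrite lt_min r10.
move=> psi spsi mkr.
have {}h1 : `|mean phi (fun x => complex.Re (a x)) - mean psi (fun x => complex.Re (a x))| < e / 2.
  by apply: h1 => //; apply: lt_le_trans mkr _; rewrite lee_fin ge_min lexx.
have {}h2 : `|mean phi (fun x => complex.Im (a x)) - mean psi (fun x => complex.Im (a x))| < e / 2.
  by apply: h2 => //; apply: lt_le_trans mkr _; rewrite lee_fin ge_min lexx orbT.
have val chi : states chi -> chi a = (mean chi (fun x => complex.Re (a x))) +i*
    (mean chi (fun x => complex.Im (a x))).
  move=> schi.
  have lin (t : R[i]) b c : chi (t *: b + c) = t * chi b + chi c.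
    by case: schi => lin _ _; exact: lin.
  rewrite {1}(c0_ReIm a) addrC lin !mean_C0//.
  by set s := mean _ _; set t := mean _ _; simpc.
apply: le_lt_trans (rnorm_le_ReIm _) _; rewrite (val _ sphi) (val _ spsi) /=; lra.
Qed.

(** The distance of [phi] to [psi] is a supremum over 1-Lipschitz [f]; as both are
    states, [f] may be shifted to have mean 0 under [mu], and it then belongs
    to [lipball x0 r]. The means of [f] are replaced by those of [f k] with
    [tame_uniform], and these are compared with [near_states]. *)
Lemma tame_mk_open S U : tame L [set: A] S -> U `<=` S -> mk_open L S U ->
  exists2 V, open V & U = S `&` V.
Proof.
move=> tS US oU; have Ss := tS.1.
have [mu [x0 [r [smu r0 loc unif]]]] := tame_uniform tS.
have near_mk phi (t : R) : S phi -> 0 < t -> \forall psi \near phi, S psi ->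
    (mk L phi psi <= t%:E)%E.
  move=> Sphi t0; have t3 : 0 < t / 3 by rewrite divr_gt0.
  have sphi := Ss _ Sphi.
  have [k [D [k0 k01 cD kD hk]]] := unif _ t3.
  have := near_states lc x0 r sphi k0 k01 cD kD t3.
  apply: (@filterS _ (nbhs phi) (@nbhs_filter _ phi)) => psi h Spsi.
  have spsi := Ss _ Spsi; apply: mk_le => //; first exact: ltW.
  move=> f f0 fl; have cf := isC0_isuC0 f0; pose w x := f x - mean mu f.
  have cw : isuC0 w.
    by apply: isuC0B => //; exact: isuC0_cst.
  have lw : lipr 1 w by move=> x y; rewrite /w opprB addrA subrK; exact: fl.
  have Ew chi : states chi -> mean chi w = mean chi f - mean mu f.
    by move=> schi; rewrite (mean_sub lc)// ?(mean_cst lc)//; exact: isuC0_cst.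
  have w0 : mean mu w = 0 by rewrite Ew// subrr.
  have Lw : lipball x0 r w.
    split=> // x; have := loc w cw lw w0; have := lw x0 x; rewrite mul1r.
    have := ler_normB (w x0) (w x0 - w x); rewrite opprB addrC subrK; lra.
  have -> : mean phi f - mean psi f = mean phi w - mean psi w by rewrite !Ew//; lra.
  have := h spsi w Lw; have := hk phi w Sphi cw lw w0; have := hk psi w Spsi cw lw w0.
  rewrite !ler_norml => /andP[h1 h2] /andP[h3 h4] /andP[h5 h6].
  by apply/andP; split; lra.
exists (interior [set psi | S psi -> U psi]); first exact: open_interior.
apply/seteqP; split => [phi Uphi|phi [Sphi /interior_subset]]; last exact.
have Sphi := US _ Uphi; split => //; have [t t0 ht] := oU _ Uphi.
have t2 : 0 < t / 2 by rewrite divr_gt0.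
have := near_mk phi _ Sphi t2.
apply: (@filterS _ (nbhs phi) (@nbhs_filter _ phi)) => psi h Spsi.
by apply: ht => //; apply: le_lt_trans (h Spsi) _; rewrite lte_fin; lra.
Qed.

(** The balls of the distance, intersected with [S], generate a filter that
    converges pointwise to their centre. *)
Lemma open_mk_open (S V : set {ptws A -> C}) :
  (forall phi, S phi -> states phi) -> open V -> mk_open L S (S `&` V).
Proof.
move=> Ss oV phi [Sphi Vphi]; have sphi := Ss _ Sphi.
pose F := filter_from [set t : R | 0 < t]
  (fun t => [set psi : {ptws A -> C} | S psi /\ (mk L phi psi < t%:E)%E]).
have FF : Filter F.
  apply: filter_from_filter; first by exists 1; exact: ltr01.
  move=> s t s0 t0; exists (Num.min s t); first by rewrite /= lt_min s0.
  move=> psi [Spsi mkst]; split; split => //; apply: lt_le_trans mkst _.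
    by rewrite lee_fin ge_min lexx.
  by rewrite lee_fin ge_min lexx orbT.
have Fphi : F --> (phi : {ptws A -> C}).
  apply/(@pointwise_cvgP _ C F phi FF) => a.
  apply/(@cvg_rnormP R C _ F FF) => e e0.
  have [t t0 ht] := mk_controls_value a sphi e0; exists t => //.
  by move=> psi [Spsi]; apply: ht; exact: Ss.
have [t t0 ht] := Fphi _ (open_nbhs_nbhs (conj oV Vphi)).
by exists t => // psi Spsi mkt; split => //; exact: ht.
Qed.

End Tame.

Theorem theorem4p1 (R : realType) (X : metricType R)
    (hX : locally_compact [set: X]) :
  qlc_metric_space (unit_ext (@Lip R X)) [set: C0 R X].
Proof.
split; first exact: Lip_regular.
move=> S tS U US; split => [|[V oV ->]]; first exact: tame_mk_open.
exact: (open_mk_open hX tS.1).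
Qed.
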